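(* Let $\zeta_5=e^{2\pi i/5}$ and write $c_k=\theta[\tfrac15;\tfrac k5]$, $d_k=\theta[\tfrac35;\tfrac k5]$ for $k\in\{1,3,5,7,9\}$ (theta constants, functions of $\tau$). For every $\tau\in\mathbb{H}^2$, $$\theta[1;\tfrac15]=-\zeta_5^2\,\frac{d_1^3c_5+\zeta_5^3d_7^3c_1}{c_3^3},\qquad \theta[1;\tfrac35]=-\zeta_5^3\,\frac{c_7^3d_5-c_9^3d_3}{d_9^3}.$$
   Context: Let $\mathbb{H}^2=\{\tau\in\mathbb{C}:\Im\tau>0\}$. For $(\epsilon,\epsilon')\in\mathbb{R}^2$, $$\theta[\epsilon;\epsilon'](\zeta,\tau)=\sum_{n\in\mathbb{Z}}\exp\Big(2\pi i\Big[\tfrac12\big(n+\tfrac{\epsilon}{2}\big)^2\tau+\big(n+\tfrac{\epsilon}{2}\big)\big(\zeta+\tfrac{\epsilon'}{2}\big)\Big]\Big),$$ and $\theta[\epsilon;\epsilon']=\theta[\epsilon;\epsilon'](0,\tau)$ denotes the theta constant. *)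

(* Defs.v *)
From Stdlib Require Import Reals ZArith.
From Coquelicot Require Import Coquelicot.
Open Scope R_scope.

Definition cexp (z : C) : C :=
  (exp (Re z) * cos (Im z), exp (Re z) * sin (Im z)).

Definition csum (a : nat -> C) : C :=
  (Series (fun n => Re (a n)), Series (fun n => Im (a n))).

Definition zsum (f : Z -> C) : C :=
  Cplus (csum (fun n => f (Z.of_nat n)))
        (csum (fun n => f (- Z.of_nat n - 1)%Z)).

Definition two_pi_i : C := (0, 2 * PI).

Definition theta_char (e e' : R) (zeta tau : C) : C :=
  zsum (fun n =>
    let m : C := RtoC (IZR n + e / 2) in
    cexp (Cmult two_pi_i
      (Cplus (Cmult (Cmult (RtoC (1/2)) (Cmult m m)) tau)
             (Cmult m (Cplus zeta (RtoC (e' / 2))))))).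

Definition theta_const (e e' : R) (tau : C) : C := theta_char e e' (RtoC 0) tau.

Definition zeta5 : C := cexp (Cmult two_pi_i (RtoC (1/5))).

Definition c_ (k : R) (tau : C) : C := theta_const (1/5) (k/5) tau.
Definition d_ (k : R) (tau : C) : C := theta_const (3/5) (k/5) tau.

(* Main.v *)
(** Centre the characteristics at the odd one, F(x,x') = theta[1+x;1+x'].  Splitting
    the double series of F(x+y) F(x-y) by the parity of m+n gives
    F(x+y) F(x-y) = - exp(pi i x) det(A(x), A(y)), where the vector A(x) consists of two
    theta constants at 2 tau.  The Pluecker relation between 2x2 determinants then yields
    Weierstrass' three-term relation, which at y = 0 specialises to both identities:
    (x,z,w) corresponds to (c_3,d_7,d_1) in the first and to (d_9,c_7,c_9) in the second.

    The denominators do not vanish: the q-binomial theorem writes a weighted partial sum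
    of theta[e;e'] as a finite product, which is bounded away from 0 when |e| < 1; the
    weights tend to 1 fast enough for the weighted sums to converge to theta[e;e']. *)

Require Import Defs.
From Stdlib Require Import Reals ZArith Lra Lia List Permutation Classical.
From Coquelicot Require Import Coquelicot.
Open Scope R_scope.

(** * Unconditional sums *)

(** The theta constants are given through two one-sided [Series], whereas splitting by parity
    permutes a double series. Summation is therefore recast over arbitrary index types as a limit
    over finite sets, a notion that is invariant under bijections and compatible with products and
    disjoint unions.

    The cubes come from the choice of points: modulo 2, x is z + w in the first identity and -(z +
    w) in the second. Up to the symmetries of theta, each of the three products then repeats its own
    squared factor, while z - w has first coordinate 0 and yields theta[1;.].

    The q-binomial theorem applies because the quotients of consecutive theta summands form a
    geometric progression. Working with its finite form avoids infinite products: only bounds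
    uniform in the number of factors are needed. *)

Definition lsum {I : Type} (f : I -> C) (L : list I) : C :=
  fold_right (fun i s => Cplus (f i) s) (RtoC 0) L.

Definition rsum {I : Type} (g : I -> R) (L : list I) : R :=
  fold_right (fun i s => g i + s) 0 L.

(** Duplicate-free lists play the role of finite subsets, directed by inclusion, so no enumeration
    of [I] is chosen. *)
Definition has_sum {I : Type} (f : I -> C) (s : C) : Prop :=
  forall eps, 0 < eps -> exists L, NoDup L /\
    forall L', NoDup L' -> incl L L' -> Cmod (lsum f L' - s) < eps.

Definition abs_bounded {I : Type} (f : I -> C) : Prop :=
  exists B, forall L, NoDup L -> rsum (fun i => Cmod (f i)) L <= B.

Lemma lsum_app {I} (f : I -> C) L1 L2 :
  lsum f (L1 ++ L2) = (lsum f L1 + lsum f L2)%C.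
Proof. induction L1 as [|a L1 IH]; simpl; [ring | rewrite IH; ring]. Qed.

Lemma rsum_app {I} (f : I -> R) L1 L2 : rsum f (L1 ++ L2) = rsum f L1 + rsum f L2.
Proof. induction L1 as [|a L1 IH]; simpl; [ring | rewrite IH; ring]. Qed.

Lemma lsum_map {I J} (h : J -> I) (f : I -> C) L :
  lsum f (map h L) = lsum (fun j => f (h j)) L.
Proof. induction L as [|a L IH]; simpl; [reflexivity | now rewrite IH]. Qed.

Lemma rsum_map {I J} (h : J -> I) (f : I -> R) L :
  rsum f (map h L) = rsum (fun j => f (h j)) L.
Proof. induction L as [|a L IH]; simpl; [reflexivity | now rewrite IH]. Qed.

Lemma lsum_ext_in {I} (f g : I -> C) L :
  (forall i, In i L -> f i = g i) -> lsum f L = lsum g L.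
Proof.
  induction L as [|a L IH]; simpl; intros H; [reflexivity|].
  rewrite H, IH; auto.
Qed.

Lemma lsum_scal {I} (c : C) (f : I -> C) L :
  lsum (fun i => (c * f i)%C) L = (c * lsum f L)%C.
Proof. induction L as [|a L IH]; simpl; [ring | rewrite IH; ring]. Qed.

Lemma lsum_plus {I} (f g : I -> C) L :
  lsum (fun i => (f i + g i)%C) L = (lsum f L + lsum g L)%C.
Proof. induction L as [|a L IH]; simpl; [ring | rewrite IH; ring]. Qed.

Lemma rsum_scal {I} (c : R) (f : I -> R) L :
  rsum (fun i => c * f i) L = c * rsum f L.
Proof. induction L as [|a L IH]; simpl; [ring | rewrite IH; ring]. Qed.

Lemma rsum_le_in {I} (f g : I -> R) L :
  (forall i, In i L -> f i <= g i) -> rsum f L <= rsum g L.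
Proof.
  induction L as [|a L IH]; simpl; intros H; [lra|].
  apply Rplus_le_compat; auto.
Qed.

Lemma rsum_ge0 {I} (f : I -> R) L : (forall i, 0 <= f i) -> 0 <= rsum f L.
Proof.
  intros H; induction L as [|a L IH]; simpl; [lra|]. specialize (H a); lra.
Qed.

Lemma Cmod_lsum_le {I} (f : I -> C) L : Cmod (lsum f L) <= rsum (fun i => Cmod (f i)) L.
Proof.
  induction L as [|a L IH]; simpl; [rewrite Cmod_0; lra|].
  eapply Rle_trans; [apply Cmod_triangle|]. lra.
Qed.

Lemma lsum_perm {I} (f : I -> C) L L' : Permutation L L' -> lsum f L = lsum f L'.
Proof.
  induction 1; simpl; try congruence; ring.
Qed.

Lemma rsum_perm {I} (f : I -> R) L L' : Permutation L L' -> rsum f L = rsum f L'.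
Proof.
  induction 1; simpl; try congruence; ring.
Qed.

Lemma lsum_list_prod {I J} (f : I -> C) (g : J -> C) L1 L2 :
  lsum (fun p => (f (fst p) * g (snd p))%C) (list_prod L1 L2) = (lsum f L1 * lsum g L2)%C.
Proof.
  induction L1 as [|a L1 IH]; simpl; [ring|].
  rewrite lsum_app, IH, lsum_map. simpl.
  rewrite lsum_scal. ring.
Qed.

Lemma rsum_list_prod {I J} (f : I -> R) (g : J -> R) L1 L2 :
  rsum (fun p => f (fst p) * g (snd p)) (list_prod L1 L2) = rsum f L1 * rsum g L2.
Proof.
  induction L1 as [|a L1 IH]; simpl; [ring|].
  rewrite rsum_app, IH, rsum_map. simpl.
  rewrite rsum_scal. ring.
Qed.

Lemma incl_permutation_app {I} (L L' : list I) :
  NoDup L -> incl L L' -> exists R, Permutation L' (L ++ R).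
Proof.
  revert L'. induction L as [|a L IH]; intros L' HL HI; [now exists L'|].
  inversion HL as [|? ? Ha HL']; subst.
  destruct (in_split a L') as [l1 [l2 E]]; [apply HI; now left|]. subst L'.
  destruct (IH (l1 ++ l2)) as [R HR]; auto.
  - intros x Hx. assert (Hx' : In x (l1 ++ a :: l2)) by (apply HI; now right).
    apply in_app_iff in Hx'. apply in_app_iff.
    destruct Hx' as [|[E|]]; auto. subst; contradiction.
  - exists R. simpl. rewrite <- HR. symmetry. apply Permutation_middle.
Qed.

Lemma rsum_incl {I} (f : I -> R) L L' : (forall i, 0 <= f i) ->
  NoDup L -> incl L L' -> rsum f L <= rsum f L'.
Proof.
  intros H0 HL HI. destruct (incl_permutation_app L L' HL HI) as [R HR].
  rewrite (rsum_perm _ _ _ HR), rsum_app. pose proof (rsum_ge0 f R H0). lra.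
Qed.

Lemma lsum_incl_diff {I} (f : I -> C) L L' : NoDup L -> incl L L' ->
  Cmod (lsum f L' - lsum f L) <= rsum (fun i => Cmod (f i)) L' - rsum (fun i => Cmod (f i)) L.
Proof.
  intros HL HI. destruct (incl_permutation_app L L' HL HI) as [R HR].
  rewrite (lsum_perm _ _ _ HR), (rsum_perm _ _ _ HR), lsum_app, rsum_app.
  replace (lsum f L + lsum f R - lsum f L)%C with (lsum f R) by ring.
  pose proof (Cmod_lsum_le f R). lra.
Qed.

Lemma NoDup_superset {I} (L1 L2 : list I) : NoDup L1 ->
  exists L, NoDup L /\ incl L1 L /\ incl L2 L.
Proof.
  intros H1. induction L2 as [|a L2 [L [HL [I1 I2]]]].
  - exists L1. repeat split; auto; intros x; [auto | intros []].
  (* Excluded middle replaces a decidable equality on the arbitrary index type. *)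
  - destruct (classic (In a L)) as [Ha|Ha].
    + exists L. repeat split; auto. intros x [E|Hx]; [now subst | auto].
    + exists (a :: L). repeat split.
      * now constructor.
      * intros x Hx; right; auto.
      * intros x [E|Hx]; [now left | right; auto].
Qed.

Lemma Cmod_sub_sym (x y : C) : Cmod (x - y) = Cmod (y - x).
Proof. rewrite <- Cmod_opp. f_equal. ring. Qed.

Lemma Cmod_sub_triangle (x y z : C) : Cmod (x - z) <= Cmod (x - y) + Cmod (y - z).
Proof.
  replace (x - z)%C with ((x - y) + (y - z))%C by ring. apply Cmod_triangle.
Qed.

Lemma Cmod_small_eq (x y : C) : (forall eps, 0 < eps -> Cmod (x - y) < eps) -> x = y.
Proof.
  intros H. assert (E : (x - y)%C = RtoC 0).
  { apply Cmod_eq_0. destruct (Rle_lt_or_eq_dec _ _ (Cmod_ge_0 (x - y))) as [h|h]; auto.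
    specialize (H _ h). lra. }
  replace x with ((x - y) + y)%C by ring. rewrite E. ring.
Qed.

Lemma has_sum_unique {I} (f : I -> C) s t : has_sum f s -> has_sum f t -> s = t.
Proof.
  intros Hs Ht. apply Cmod_small_eq. intros eps He.
  destruct (Hs (eps / 2)) as [L1 [N1 H1]]; [lra|].
  destruct (Ht (eps / 2)) as [L2 [N2 H2]]; [lra|].
  destruct (NoDup_superset L1 L2 N1) as [L [N [I1 I2]]].
  specialize (H1 L N I1). specialize (H2 L N I2).
  pose proof (Cmod_sub_triangle s (lsum f L) t).
  rewrite (Cmod_sub_sym s (lsum f L)) in H. lra.
Qed.

Lemma has_sum_ext {I} (f g : I -> C) s : (forall i, f i = g i) -> has_sum f s -> has_sum g s.
Proof.
  intros E H eps He. destruct (H eps He) as [L [N HL]]. exists L; split; auto.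
  intros L' N' I'. rewrite <- (lsum_ext_in f g); auto.
Qed.

Lemma has_sum_scal {I} (c : C) (f : I -> C) s :
  has_sum f s -> has_sum (fun i => (c * f i)%C) (c * s)%C.
Proof.
  intros H eps He.
  assert (Hc : 0 < Cmod c + 1) by (pose proof (Cmod_ge_0 c); lra).
  destruct (H (eps / (Cmod c + 1))) as [L [N HL]]; [now apply Rdiv_lt_0_compat|].
  exists L; split; auto. intros L' N' I'. specialize (HL L' N' I').
  rewrite lsum_scal.
  replace (c * lsum f L' - c * s)%C with (c * (lsum f L' - s))%C by ring.
  rewrite Cmod_mult. pose proof (Cmod_ge_0 c). pose proof (Cmod_ge_0 (lsum f L' - s)).
  apply Rle_lt_trans with (Cmod (lsum f L' - s) * Cmod c); [lra|].
  apply Rle_lt_trans with ((eps / (Cmod c + 1)) * Cmod c).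
  - apply Rmult_le_compat_r; lra.
  - assert (0 < eps / (Cmod c + 1)) by now apply Rdiv_lt_0_compat.
    replace eps with (eps / (Cmod c + 1) * (Cmod c + 1)) at 2 by (field; lra). nra.
Qed.

Lemma has_sum_reindex {I J} (h : J -> I) (k : I -> J) (f : I -> C) s :
  (forall i, h (k i) = i) -> (forall j, k (h j) = j) ->
  has_sum f s -> has_sum (fun j => f (h j)) s.
Proof.
  intros hk kh H eps He. destruct (H eps He) as [L [N HL]].
  exists (map k L). split.
  - apply FinFun.Injective_map_NoDup; auto.
    intros x y E. rewrite <- (hk x), <- (hk y). now rewrite E.
  - intros L' N' I'. rewrite <- lsum_map. apply HL.
    + apply FinFun.Injective_map_NoDup; auto.
      intros x y E. rewrite <- (kh x), <- (kh y). now rewrite E.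
    + intros x Hx. apply in_map_iff. exists (k x). split; auto.
      apply I'. now apply in_map.
Qed.

Lemma list_sum_permutation {I J} (L : list (I + J)) :
  exists L1 L2, Permutation L (map inl L1 ++ map inr L2).
Proof.
  induction L as [|a L [L1 [L2 P]]].
  - exists nil, nil. constructor.
  - destruct a as [i|j].
    + exists (i :: L1), L2. simpl. now constructor.
    + exists L1, (j :: L2). rewrite P. simpl. apply Permutation_middle.
Qed.

Lemma has_sum_sum {I J} (f : I + J -> C) s t :
  has_sum (fun i => f (inl i)) s -> has_sum (fun j => f (inr j)) t -> has_sum f (s + t)%C.
Proof.
  intros Hs Ht eps He.
  destruct (Hs (eps / 2)) as [L1 [N1 H1]]; [lra|].
  destruct (Ht (eps / 2)) as [L2 [N2 H2]]; [lra|].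
  assert (disj : forall (A : list I) (B : list J) x, In x (map inl A) -> ~ In x (map (@inr I J) B)).
  { intros A B x Hx Hy. apply in_map_iff in Hx. apply in_map_iff in Hy.
    destruct Hx as [a [E _]], Hy as [b [E' _]]. congruence. }
  exists (map inl L1 ++ map inr L2). split.
  - apply NoDup_app; [| |exact (disj L1 L2)];
      apply FinFun.Injective_map_NoDup; auto; intros x y E; congruence.
  - intros L' N' I'. destruct (list_sum_permutation L') as [A [B P]].
    rewrite (lsum_perm _ _ _ P), lsum_app, !lsum_map.
    assert (N'' := Permutation_NoDup P N').
    assert (HA : Cmod (lsum (fun i => f (inl i)) A - s) < eps / 2).
    { apply H1.
      - eapply NoDup_map_inv. eapply NoDup_app_remove_r. exact N''.
      - intros x Hx. assert (Hi : In (inl x) L').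
        { apply I'. apply in_app_iff; left. now apply in_map. }
        apply (Permutation_in _ P) in Hi. apply in_app_iff in Hi.
        destruct Hi as [Hi|Hi]; apply in_map_iff in Hi; destruct Hi as [y [E Hy]];
          inversion E; now subst. }
    assert (HB : Cmod (lsum (fun i => f (inr i)) B - t) < eps / 2).
    { apply H2.
      - eapply NoDup_map_inv. eapply NoDup_app_remove_l. exact N''.
      - intros x Hx. assert (Hi : In (inr x) L').
        { apply I'. apply in_app_iff; right. now apply in_map. }
        apply (Permutation_in _ P) in Hi. apply in_app_iff in Hi.
        destruct Hi as [Hi|Hi]; apply in_map_iff in Hi; destruct Hi as [y [E Hy]];
          inversion E; now subst. }
    replace (lsum (fun i => f (inl i)) A + lsum (fun j => f (inr j)) B - (s + t))%C
      with ((lsum (fun i => f (inl i)) A - s) + (lsum (fun j => f (inr j)) B - t))%C by ring.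
    eapply Rle_lt_trans; [apply Cmod_triangle|]. lra.
Qed.

(** Take [L] with absolute sum within [eps] of the supremum over all finite sets. Applied to
    supersets of [L], this bounds everything outside [L] by [eps]. *)
Lemma abs_bounded_tail {I} (f : I -> C) : abs_bounded f ->
  forall eps, 0 < eps -> exists L, NoDup L /\ forall L', NoDup L' ->
    rsum (fun i => Cmod (f i)) L' <= rsum (fun i => Cmod (f i)) L + eps.
Proof.
  intros [B HB] eps He.
  destruct (completeness (fun x => exists L, NoDup L /\ x = rsum (fun i => Cmod (f i)) L))
    as [M [ub lub]].
  - exists B. intros x [L [N E]]. subst. auto.
  - exists 0, nil. split; [constructor | reflexivity].
  - apply NNPP. intros Hn.
    assert (M <= M - eps); [|lra].
    apply lub. intros x [L [N E]]. subst.
    apply Rnot_lt_le. intros Hlt. apply Hn. exists L. split; auto.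
    intros L' N'. assert (rsum (fun i => Cmod (f i)) L' <= M) by (apply ub; eauto). lra.
Qed.

Lemma NoDup_list_prod {I J} (L1 : list I) (L2 : list J) :
  NoDup L1 -> NoDup L2 -> NoDup (list_prod L1 L2).
Proof.
  intros N1 N2. induction L1 as [|a L1 IH]; simpl; [constructor|].
  inversion N1; subst. apply NoDup_app; auto.
  - apply FinFun.Injective_map_NoDup; auto. intros x y E; congruence.
  - intros [x y] Hx Hy. apply in_map_iff in Hx. destruct Hx as [b [E _]].
    apply in_prod_iff in Hy. inversion E; subst. tauto.
Qed.

(** A finite set of pairs containing the rectangle [L1] x [L2] lies in a larger rectangle [M1] x
    [M2]. What it adds to the sum over the small rectangle is at most the difference of the two
    absolute sums, and these factorise. *)
Lemma has_sum_prod {I J} (f : I -> C) (g : J -> C) s t :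
  abs_bounded f -> abs_bounded g -> has_sum f s -> has_sum g t ->
  has_sum (fun p => (f (fst p) * g (snd p))%C) (s * t)%C.
Proof.
  intros Bf Bg Hs Ht eps He.
  set (F := rsum (fun i => Cmod (f i))). set (G := rsum (fun i => Cmod (g i))).
  assert (F0 : forall L, 0 <= F L) by (intros; apply rsum_ge0; intros; apply Cmod_ge_0).
  assert (G0 : forall L, 0 <= G L) by (intros; apply rsum_ge0; intros; apply Cmod_ge_0).
  pose proof Bf as [A HA]. pose proof Bg as [B HB].
  assert (A0 : 0 <= A) by (specialize (HA nil (NoDup_nil _)); simpl in HA; lra).
  assert (B0 : 0 <= B) by (specialize (HB nil (NoDup_nil _)); simpl in HB; lra).
  (* [K] adds up the coefficients of [e] in the two estimates [D1] and [D2] below; taking [e <= 1]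
     lets the quadratic terms in [e] be absorbed into the two summands 1. *)
  set (K := A + B + 1 + (Cmod t + Cmod s + 1)).
  assert (K1 : 1 < K) by (unfold K; pose proof (Cmod_ge_0 s); pose proof (Cmod_ge_0 t); lra).
  set (e := Rmin 1 (eps / (2 * K))).
  assert (e0 : 0 < e) by (apply Rmin_pos; [lra | apply Rdiv_lt_0_compat; lra]).
  assert (e1 : e <= 1) by apply Rmin_l.
  assert (eK : e * K <= eps / 2).
  { apply Rle_trans with (eps / (2 * K) * K).
    - apply Rmult_le_compat_r; [lra | apply Rmin_r].
    - right; field; lra. }
  destruct (abs_bounded_tail f Bf e e0) as [P1 [NP1 TP1]].
  destruct (abs_bounded_tail g Bg e e0) as [P2 [NP2 TP2]].
  destruct (Hs e e0) as [Q1 [NQ1 TQ1]]. destruct (Ht e e0) as [Q2 [NQ2 TQ2]].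
  destruct (NoDup_superset P1 Q1 NP1) as [L1 [N1 [IP1 IQ1]]].
  destruct (NoDup_superset P2 Q2 NP2) as [L2 [N2 [IP2 IQ2]]].
  specialize (TQ1 L1 N1 IQ1). specialize (TQ2 L2 N2 IQ2).
  assert (GP1 : F P1 <= F L1) by (apply rsum_incl; auto; intros; apply Cmod_ge_0).
  assert (GP2 : G P2 <= G L2) by (apply rsum_incl; auto; intros; apply Cmod_ge_0).
  exists (list_prod L1 L2). split; [now apply NoDup_list_prod|].
  intros L' N' I'.
  destruct (NoDup_superset L1 (map fst L') N1) as [M1 [NM1 [IL1 IM1]]].
  destruct (NoDup_superset L2 (map snd L') N2) as [M2 [NM2 [IL2 IM2]]].
  assert (D : Cmod (lsum (fun p => (f (fst p) * g (snd p))%C) L' - lsum f L1 * lsum g L2)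
              <= F M1 * G M2 - F L1 * G L2).
  { rewrite <- lsum_list_prod.
    eapply Rle_trans; [apply lsum_incl_diff; auto; now apply NoDup_list_prod|].
    assert (E : forall X : list (I * J), rsum (fun i => Cmod (f (fst i) * g (snd i))) X =
       rsum (fun i => Cmod (f (fst i)) * Cmod (g (snd i))) X).
    { intros X. induction X as [|x X IH]; simpl; auto. now rewrite IH, Cmod_mult. }
    pose proof (rsum_list_prod (fun a => Cmod (f a)) (fun b => Cmod (g b))) as RP.
    cbv beta in RP. fold F G in RP.
    rewrite !E, RP.
    assert (rsum (fun i => Cmod (f (fst i)) * Cmod (g (snd i))) L' <= F M1 * G M2); [|lra].
    rewrite <- RP. apply rsum_incl; auto.
    - intros; apply Rmult_le_pos; apply Cmod_ge_0.
    - intros [x y] Hx. apply in_prod_iff. split.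
      + apply IM1. now apply (in_map fst) in Hx.
      + apply IM2. now apply (in_map snd) in Hx. }
  specialize (TP1 M1 NM1). specialize (TP2 M2 NM2). fold F in TP1. fold G in TP2.
  assert (D1 : F M1 * G M2 - F L1 * G L2 <= e * (A + B + 1)).
  { assert (F M1 <= F L1 + e) by lra. assert (G M2 <= G L2 + e) by lra.
    assert (F L1 <= A) by now apply HA. assert (G L2 <= B) by now apply HB.
    pose proof (F0 L1). pose proof (G0 L2). pose proof (F0 M1). pose proof (G0 M2).
    assert (F M1 * G M2 <= (F L1 + e) * (G L2 + e)) by (apply Rmult_le_compat; lra).
    nra. }
  assert (D2 : Cmod (lsum f L1 * lsum g L2 - s * t) <= e * (Cmod t + Cmod s + 1)).
  { set (x := lsum f L1) in *. set (y := lsum g L2) in *.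
    replace (x * y - s * t)%C with ((x - s) * (y - t) + ((x - s) * t + s * (y - t)))%C by ring.
    eapply Rle_trans; [apply Cmod_triangle|].
    eapply Rle_trans; [apply Rplus_le_compat_l, Cmod_triangle|].
    rewrite !Cmod_mult.
    pose proof (Cmod_ge_0 (x - s)). pose proof (Cmod_ge_0 (y - t)).
    pose proof (Cmod_ge_0 s). pose proof (Cmod_ge_0 t). nra. }
  eapply Rle_lt_trans; [apply (Cmod_sub_triangle _ (lsum f L1 * lsum g L2)%C)|].
  unfold K in eK. nra.
Qed.

(** * Bilateral series *)

(** Laid out like the two halves of [zsum], so that sums over it are sums of their partial sums. *)
Definition zbox (N : nat) : list Z :=
  map Z.of_nat (seq 0 N) ++ map (fun n => (- Z.of_nat n - 1)%Z) (seq 0 N).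

Lemma in_zbox N z : In z (zbox N) <-> (- Z.of_nat N <= z < Z.of_nat N)%Z.
Proof.
  unfold zbox. rewrite in_app_iff, !in_map_iff. split.
  - intros [[n [E Hn]]|[n [E Hn]]]; apply in_seq in Hn; lia.
  - intros H. destruct (Z_lt_le_dec z 0).
    + right. exists (Z.to_nat (- z - 1)). rewrite in_seq. lia.
    + left. exists (Z.to_nat z). rewrite in_seq. lia.
Qed.

Lemma NoDup_zbox N : NoDup (zbox N).
Proof.
  apply NoDup_app.
  - apply FinFun.Injective_map_NoDup; [|apply seq_NoDup]. intros x y E; lia.
  - apply FinFun.Injective_map_NoDup; [|apply seq_NoDup]. intros x y E; lia.
  - intros x Hx Hy. apply in_map_iff in Hx. apply in_map_iff in Hy.
    destruct Hx as [? [? _]], Hy as [? [? _]]. lia.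
Qed.

Lemma incl_zbox (L : list Z) : exists N0, forall N, (N0 <= N)%nat -> incl L (zbox N).
Proof.
  induction L as [|a L [N0 H]].
  - exists 0%nat. intros N _ x [].
  - exists (Nat.max N0 (S (Z.abs_nat a))). intros N HN x [E|Hx].
    + subst. apply in_zbox. lia.
    + apply H; auto. lia.
Qed.

Lemma rsum_geom_le r N : 0 <= r < 1 -> rsum (fun n => r ^ n) (seq 0 N) <= / (1 - r).
Proof.
  intros Hr.
  assert (E : (1 - r) * rsum (fun n => r ^ n) (seq 0 N) = 1 - r ^ N).
  { induction N as [|N IH]; [simpl; ring|].
    rewrite seq_S, rsum_app. simpl. rewrite Rmult_plus_distr_l, IH. ring. }
  apply Rmult_le_reg_l with (1 - r); [lra|]. rewrite E, Rinv_r by lra.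
  pose proof (pow_le r N). lra.
Qed.

Definition geom_decay (f : Z -> C) (K r : R) : Prop :=
  0 <= r < 1 /\ forall n, Cmod (f n) <= K * r ^ Z.abs_nat n.

Lemma geom_decay_const_ge0 f K r : geom_decay f K r -> 0 <= K.
Proof.
  intros [_ H]. specialize (H 0%Z). simpl in H. pose proof (Cmod_ge_0 (f 0%Z)). lra.
Qed.

Lemma geom_decay_pos f K r n : geom_decay f K r -> Cmod (f (Z.of_nat n)) <= K * r ^ n.
Proof.
  intros [_ H]. specialize (H (Z.of_nat n)). now rewrite Zabs2Nat.id in H.
Qed.

Lemma geom_decay_neg f K r n : geom_decay f K r -> Cmod (f (- Z.of_nat n - 1)%Z) <= K * r ^ n.
Proof.
  intros G. pose proof (geom_decay_const_ge0 _ _ _ G). destruct G as [Hr H'].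
  (* The negative half starts at -1, so its n-th index has absolute value n + 1; the spare factor
     [r] is bounded by 1. *)
  eapply Rle_trans; [apply H'|]. replace (Z.abs_nat (- Z.of_nat n - 1)) with (S n) by lia.
  simpl. pose proof (Rmult_le_pos K (r ^ n) H (pow_le r n (proj1 Hr))). nra.
Qed.

Lemma geom_decay_abs_bounded f K r : geom_decay f K r -> abs_bounded f.
Proof.
  intros G. pose proof (geom_decay_const_ge0 _ _ _ G) as HK. pose proof G as [Hr _].
  exists (K * / (1 - r) + K * / (1 - r)). intros L N.
  destruct (incl_zbox L) as [M HM]. specialize (HM M (le_n _)).
  eapply Rle_trans; [apply rsum_incl; eauto; intros; apply Cmod_ge_0|].
  unfold zbox. rewrite rsum_app, !rsum_map.
  apply Rplus_le_compat;
    (eapply Rle_trans; [apply rsum_le_in with (g := fun n => K * r ^ n)|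
      rewrite rsum_scal; apply Rmult_le_compat_l; [lra | now apply rsum_geom_le]]).
  - intros i _. now apply geom_decay_pos.
  - intros i _. now apply geom_decay_neg.
Qed.

Lemma Cmod_le_Rabs_sum (z : C) : Cmod z <= Rabs (Re z) + Rabs (Im z).
Proof.
  destruct z as [x y]. unfold Re, Im; simpl.
  replace (x, y) with (RtoC x + Ci * RtoC y)%C.
  - eapply Rle_trans; [apply Cmod_triangle|].
    rewrite Cmod_mult, Cmod_Ci, !Cmod_R. lra.
  - unfold Cplus, Cmult, RtoC, Ci; simpl. f_equal; ring.
Qed.

Lemma im_le_Cmod (z : C) : Rabs (Im z) <= Cmod z.
Proof.
  eapply Rle_trans; [|apply Rmax_Cmod]. apply Rmax_r.
Qed.

Lemma Re_lsum_seq (a : nat -> C) N : Re (lsum a (seq 0 (S N))) = sum_n (fun n => Re (a n)) N.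
Proof.
  induction N as [|N IH].
  - rewrite sum_O. cbn [lsum fold_right seq]. rewrite re_plus, re_RtoC. apply Rplus_0_r.
  - rewrite seq_S, lsum_app, re_plus, IH, sum_Sn. cbn [lsum fold_right Nat.add].
    rewrite re_plus, re_RtoC, Rplus_0_r. reflexivity.
Qed.

Lemma Im_lsum_seq (a : nat -> C) N : Im (lsum a (seq 0 (S N))) = sum_n (fun n => Im (a n)) N.
Proof.
  induction N as [|N IH].
  - rewrite sum_O. cbn [lsum fold_right seq]. rewrite im_plus, im_RtoC. apply Rplus_0_r.
  - rewrite seq_S, lsum_app, im_plus, IH, sum_Sn. cbn [lsum fold_right Nat.add].
    rewrite im_plus, im_RtoC, Rplus_0_r. reflexivity.
Qed.

Lemma csum_cvg (a : nat -> C) K r : 0 <= r < 1 -> (forall n, Cmod (a n) <= K * r ^ n) ->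
  forall eps, 0 < eps -> exists N0, forall N, (N0 <= N)%nat ->
    Cmod (lsum a (seq 0 N) - csum a) < eps.
Proof.
  intros Hr Ha eps He.
  (* [Series] is total, so its value is a limit only once convergence of the real and imaginary
     parts is known; comparison with the geometric series supplies it. *)
  assert (Hg : ex_series (fun n => K * r ^ n)).
  { apply (ex_series_scal_l (V := R_NormedModule) K (fun n => r ^ n)). apply ex_series_geom.
    rewrite Rabs_pos_eq; lra. }
  assert (HR : ex_series (fun n => Re (a n))).
  { apply (ex_series_le (V := R_CompleteNormedModule)) with (2 := Hg). intros n.
    eapply Rle_trans; [apply re_le_Cmod | apply Ha]. }
  assert (HI : ex_series (fun n => Im (a n))).
  { apply (ex_series_le (V := R_CompleteNormedModule)) with (2 := Hg). intros n.
    eapply Rle_trans; [apply im_le_Cmod | apply Ha]. }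
  apply Series_correct in HR. apply Series_correct in HI.
  assert (e2 : 0 < eps / 2) by lra.
  apply is_series_Reals in HR. apply is_series_Reals in HI.
  destruct (HR (eps / 2) e2) as [N1 H1]. destruct (HI (eps / 2) e2) as [N2 H2].
  (* The successor is needed because [sum_n] up to N has N + 1 terms, matching [seq 0 (S N)]. *)
  exists (S (Nat.max N1 N2)). intros N HN. destruct N as [|N]; [lia|].
  specialize (H1 N ltac:(lia)). specialize (H2 N ltac:(lia)).
  rewrite <- sum_n_Reals in H1, H2. unfold R_dist in *.
  eapply Rle_lt_trans; [apply Cmod_le_Rabs_sum|].
  unfold Cminus. rewrite re_plus, im_plus, re_opp, im_opp, Re_lsum_seq, Im_lsum_seq.
  unfold csum at 1 2. simpl Re. simpl Im. unfold Rminus in *. lra.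
Qed.

Lemma zsum_cvg f K r : geom_decay f K r ->
  forall eps, 0 < eps -> exists N0, forall N, (N0 <= N)%nat ->
    Cmod (lsum f (zbox N) - zsum f) < eps.
Proof.
  intros G eps He. pose proof G as [Hr _]. assert (e2 : 0 < eps / 2) by lra.
  destruct (csum_cvg (fun n => f (Z.of_nat n)) K r Hr
    (fun n => geom_decay_pos f K r n G) _ e2) as [N1 H1].
  destruct (csum_cvg (fun n => f (- Z.of_nat n - 1)%Z) K r Hr
    (fun n => geom_decay_neg f K r n G) _ e2) as [N2 H2].
  exists (Nat.max N1 N2). intros N HN.
  specialize (H1 N ltac:(lia)). specialize (H2 N ltac:(lia)).
  unfold zbox, zsum. rewrite lsum_app, !lsum_map.
  match goal with |- Cmod (?a + ?b - (?c + ?d)) < _ =>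
    replace (a + b - (c + d))%C with ((a - c) + (b - d))%C by ring end.
  eapply Rle_lt_trans; [apply Cmod_triangle|]. lra.
Qed.

(** A finite set [L'] containing [L] is enclosed in a large box. The box sum is close to [zsum f],
    and the terms of the box outside [L'] contribute little because [L] already carries nearly all
    of the absolute sum. *)
Lemma has_sum_zsum f K r : geom_decay f K r -> has_sum f (zsum f).
Proof.
  intros G eps He.
  assert (e2 : 0 < eps / 2) by lra.
  destruct (abs_bounded_tail f (geom_decay_abs_bounded _ _ _ G) _ e2) as [L [N HL]].
  exists L. split; auto. intros L' N' I'.
  destruct (incl_zbox L') as [M1 H1].
  destruct (zsum_cvg f K r G _ e2) as [M2 H2].
  set (M := Nat.max M1 M2). specialize (H1 M ltac:(lia)). specialize (H2 M ltac:(lia)).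
  pose proof (lsum_incl_diff f _ _ N' H1) as D.
  specialize (HL _ (NoDup_zbox M)).
  assert (rsum (fun i => Cmod (f i)) L <= rsum (fun i => Cmod (f i)) L')
    by (apply rsum_incl; auto; intros; apply Cmod_ge_0).
  pose proof (Cmod_sub_triangle (lsum f L') (lsum f (zbox M)) (zsum f)) as T.
  rewrite (Cmod_sub_sym _ (lsum f (zbox M))) in T. lra.
Qed.

(** * Theta series *)

Definition ipi : C := (0, PI).

Definition ee (r : R) : C := cexp (ipi * RtoC r)%C.

(** The summand depends on n and e only through the real point x = n + e/2, so changes of e become
    bijections of the index. *)
Definition theta_term (e' : R) (tau : C) (x : R) : C :=
  cexp (ipi * (RtoC (x * x) * tau + RtoC (x * e')))%C.

Lemma cexp_plus (a b : C) : cexp (a + b)%C = (cexp a * cexp b)%C.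
Proof.
  unfold cexp. rewrite re_plus, im_plus, exp_plus, cos_plus, sin_plus.
  unfold Cmult; simpl. f_equal; ring.
Qed.

Lemma Cmod_cexp (z : C) : Cmod (cexp z) = exp (Re z).
Proof.
  unfold cexp, Cmod; simpl fst; simpl snd.
  replace ((exp (Re z) * cos (Im z)) ^ 2 + (exp (Re z) * sin (Im z)) ^ 2)
    with (exp (Re z) ^ 2 * (Rsqr (sin (Im z)) + Rsqr (cos (Im z)))) by (unfold Rsqr; ring).
  rewrite sin2_cos2, Rmult_1_r. apply sqrt_pow2. left; apply exp_pos.
Qed.

Lemma cexp_0 : cexp (RtoC 0) = RtoC 1.
Proof.
  unfold cexp, RtoC; simpl. rewrite exp_0, cos_0, sin_0. f_equal; ring.
Qed.

Lemma cexp_neq0 z : cexp z <> RtoC 0.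
Proof.
  apply Cmod_gt_0. rewrite Cmod_cexp. apply exp_pos.
Qed.

Ltac c_eq := unfold ipi, two_pi_i, Cplus, Cmult, Copp, Cminus, RtoC; simpl; f_equal; try field.

Lemma ee_plus r s : ee (r + s) = (ee r * ee s)%C.
Proof. unfold ee. rewrite <- cexp_plus. f_equal. c_eq. Qed.

Lemma ee_0 : ee 0 = RtoC 1.
Proof. unfold ee. rewrite <- cexp_0. f_equal. c_eq. Qed.

Lemma ee_1 : ee 1 = (- RtoC 1)%C.
Proof.
  unfold ee, cexp, ipi, RtoC, Copp; simpl.
  replace (0 * 1 - PI * 0) with 0 by ring. replace (0 * 0 + PI * 1) with PI by ring.
  rewrite exp_0, cos_PI, sin_PI. f_equal; ring.
Qed.

Lemma ee_2Z (n : Z) : ee (2 * IZR n) = RtoC 1.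
Proof.
  unfold ee, cexp, ipi, RtoC; simpl.
  replace (0 * (2 * IZR n) - PI * 0) with 0 by ring.
  replace (0 * 0 + PI * (2 * IZR n)) with (2 * (IZR n * PI)) by ring.
  rewrite exp_0, cos_2a_sin, sin_2a, (sin_eq_0_1 (IZR n * PI)) by (now exists n).
  f_equal; ring.
Qed.

Lemma zsum_ext f g : (forall n, f n = g n) -> zsum f = zsum g.
Proof.
  intros H. unfold zsum, csum. f_equal; f_equal; apply Series_ext; intros n; now rewrite H.
Qed.

Lemma theta_const_zsum e e' tau :
  theta_const e e' tau = zsum (fun n => theta_term e' tau (IZR n + e / 2)).
Proof.
  unfold theta_const, theta_char. apply zsum_ext. intros n.
  unfold theta_term. f_equal. destruct tau as [u v]. c_eq.
Qed.

Lemma Cmod_theta_term e' tau x : Cmod (theta_term e' tau x) = exp (- (PI * Im tau) * (x * x)).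
Proof.
  unfold theta_term. rewrite Cmod_cexp. f_equal. destruct tau as [u v].
  unfold ipi, RtoC; simpl. ring.
Qed.

Lemma exp_le_compat x y : x <= y -> exp x <= exp y.
Proof.
  intros [H|H]; [left; now apply exp_increasing | right; now rewrite H].
Qed.

(** Gaussian decay beats every geometric rate. The rate is left free because the non-vanishing proof
    takes it equal to the modulus of [nome2 tau]. *)
Lemma theta_term_decay e e' tau r : 0 < Im tau -> 0 < r < 1 ->
  exists K, geom_decay (fun n => theta_term e' tau (IZR n + e / 2)) K r.
Proof.
  intros Ht Hr. set (c := PI * Im tau).
  assert (Hc : 0 < c) by (apply Rmult_lt_0_compat; auto; apply PI_RGT_0).
  set (l := - ln r).
  assert (Hl : 0 < l) by (pose proof (ln_increasing r 1 (proj1 Hr) (proj2 Hr)); rewrite ln_1 in *; unfold l; lra).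
  (* The first summand comes from completing the square in l|x| - c x^2, the second from |n| <= |x|
     + |e/2|. *)
  exists (exp (l * l / (4 * c) + l * Rabs (e / 2))). split; [lra|]. intros n.
  rewrite Cmod_theta_term. fold c.
  rewrite <- Rpower_pow by lra. unfold Rpower. rewrite <- exp_plus.
  apply exp_le_compat. set (x := IZR n + e / 2).
  assert (Hn : INR (Z.abs_nat n) <= Rabs x + Rabs (e / 2)).
  { replace (INR (Z.abs_nat n)) with (Rabs (IZR n)).
    - replace (IZR n) with (x - e / 2) by (unfold x; ring).
      eapply Rle_trans; [apply Rabs_triang|]. rewrite Rabs_Ropp. lra.
    - rewrite INR_IZR_INZ, Zabs2Nat.id_abs, abs_IZR. reflexivity. }
  replace (ln r) with (- l) by (unfold l; ring).
  assert (l * Rabs x <= l * l / (4 * c) + c * (x * x)).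
  { replace (x * x) with (Rabs x * Rabs x) by (rewrite <- Rabs_mult; apply Rabs_pos_eq; nra).
    assert (0 <= (l - 2 * c * Rabs x) ^ 2 / (4 * c)).
    { apply Rdiv_le_0_compat; [apply pow2_ge_0 | lra]. }
    replace ((l - 2 * c * Rabs x) ^ 2 / (4 * c))
      with (l * l / (4 * c) + c * (Rabs x * Rabs x) - l * Rabs x) in H by (field; lra).
    lra. }
  assert (l * INR (Z.abs_nat n) <= l * (Rabs x + Rabs (e / 2))) by (apply Rmult_le_compat_l; lra).
  lra.
Qed.

Lemma theta_term_abs_bounded e e' tau : 0 < Im tau ->
  abs_bounded (fun n => theta_term e' tau (IZR n + e / 2)).
Proof.
  intros Ht. destruct (theta_term_decay e e' tau (1/2) Ht) as [K G]; [lra|].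
  exact (geom_decay_abs_bounded _ _ _ G).
Qed.

Lemma theta_const_has_sum e e' tau : 0 < Im tau ->
  has_sum (fun n => theta_term e' tau (IZR n + e / 2)) (theta_const e e' tau).
Proof.
  intros Ht. destruct (theta_term_decay e e' tau (1/2) Ht) as [K G]; [lra|].
  rewrite theta_const_zsum. exact (has_sum_zsum _ _ _ G).
Qed.

Lemma theta_const_plus2_l e e' tau : 0 < Im tau ->
  theta_const (e + 2) e' tau = theta_const e e' tau.
Proof.
  intros Ht. apply (has_sum_unique (fun n => theta_term e' tau (IZR n + (e + 2) / 2))).
  - now apply theta_const_has_sum.
  - apply (has_sum_ext (fun n => theta_term e' tau (IZR (n + 1) + e / 2))).
    + intros n. f_equal. rewrite plus_IZR. field.
    + apply (has_sum_reindex (fun n => (n + 1)%Z) (fun n => (n - 1)%Z)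
               (fun n => theta_term e' tau (IZR n + e / 2))); try (intros; lia).
      now apply theta_const_has_sum.
Qed.

Lemma theta_const_opp e e' tau : 0 < Im tau ->
  theta_const (- e) (- e') tau = theta_const e e' tau.
Proof.
  intros Ht. apply (has_sum_unique (fun n => theta_term (- e') tau (IZR n + (- e) / 2))).
  - now apply theta_const_has_sum.
  - apply (has_sum_ext (fun n => theta_term e' tau (IZR (- n) + e / 2))).
    + intros n. unfold theta_term. rewrite opp_IZR. f_equal. destruct tau as [u v]. c_eq.
    + apply (has_sum_reindex (fun n => (- n)%Z) (fun n => (- n)%Z)
               (fun n => theta_term e' tau (IZR n + e / 2))); try (intros; lia).
      now apply theta_const_has_sum.
Qed.

Lemma theta_const_plus2_r e e' tau : 0 < Im tau ->
  theta_const e (e' + 2) tau = (ee e * theta_const e e' tau)%C.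
Proof.
  intros Ht. apply (has_sum_unique (fun n => theta_term (e' + 2) tau (IZR n + e / 2))).
  - now apply theta_const_has_sum.
  - apply (has_sum_ext (fun n => (ee e * theta_term e' tau (IZR n + e / 2))%C)).
    (* The n-th term gains exp(2 pi i (n + e/2)); the integer part of the exponent is inserted as a
       factor 1. *)
    + intros n. rewrite <- (Cmult_1_l (ee e)), <- (ee_2Z n), <- ee_plus.
      unfold ee, theta_term. rewrite <- cexp_plus. f_equal. destruct tau as [u v]. c_eq.
    + now apply has_sum_scal, theta_const_has_sum.
Qed.

(** * Products of theta constants at tau in terms of theta constants at 2 tau *)

Definition parity_join (p : (Z * Z) + (Z * Z)) : Z * Z :=
  match p with
  | inl (i, j) => (i + j, i - j)%Z
  | inr (i, j) => (i + j + 1, i - j)%Z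
  end.

(** Since m + n and m - n have the same parity, floor division gives the same formulas in both
    branches. *)
Definition parity_split (p : Z * Z) : (Z * Z) + (Z * Z) :=
  let (m, n) := p in
  if Z.even (m + n) then inl ((m + n) / 2, (m - n) / 2)%Z
  else inr ((m + n) / 2, (m - n) / 2)%Z.

Lemma parity_join_split p : parity_join (parity_split p) = p.
Proof.
  destruct p as [m n]. unfold parity_split. destruct (Z.even (m + n)) eqn:E; simpl.
  - apply Z.even_spec in E. destruct E as [k E].
    replace (m - n)%Z with ((k - n) * 2)%Z by lia. replace (m + n)%Z with (k * 2)%Z by lia.
    rewrite !Z.div_mul by lia. f_equal; lia.
  - assert (O : Z.odd (m + n) = true) by (now rewrite <- Z.negb_even, E).
    apply Z.odd_spec in O. destruct O as [k O].
    replace (m - n)%Z with (1 + (k - n) * 2)%Z by lia.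
    replace (m + n)%Z with (1 + k * 2)%Z by lia.
    rewrite !Z.div_add by lia. change (1 / 2)%Z with 0%Z. f_equal; lia.
Qed.

Lemma parity_split_join p : parity_split (parity_join p) = p.
Proof.
  destruct p as [[i j]|[i j]]; unfold parity_join, parity_split.
  - replace (i + j + (i - j))%Z with (i * 2)%Z by lia.
    replace (i + j - (i - j))%Z with (j * 2)%Z by lia.
    rewrite !Z.div_mul by lia.
    replace (Z.even (i * 2)) with true; auto. symmetry. apply Z.even_spec. exists i; lia.
  - replace (i + j + 1 + (i - j))%Z with (1 + i * 2)%Z by lia.
    replace (i + j + 1 - (i - j))%Z with (1 + j * 2)%Z by lia.
    rewrite !Z.div_add by lia.
    replace (Z.even (1 + i * 2)) with false; auto. symmetry.
    rewrite <- Z.negb_odd. apply Bool.negb_false_iff. apply Z.odd_spec. exists i; lia.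
Qed.

(** For x = m + a/2 and y = n + b/2 one has x^2 + y^2 = 2 ((x+y)/2)^2 + 2 ((x-y)/2)^2, which doubles
    tau and separates the variables (x+y)/2 and (x-y)/2. These lie in shifted copies of Z when m + n
    is even, and are moved by a further 1/2 when it is odd, hence the characteristics 1 + ... in the
    second product. *)
Lemma theta_const_mult a a' b b' tau : 0 < Im tau ->
  (theta_const a a' tau * theta_const b b' tau)%C =
  (theta_const ((a + b) / 2) (a' + b') (2 * tau)
     * theta_const ((a - b) / 2) (a' - b') (2 * tau)
   + theta_const (1 + (a + b) / 2) (a' + b') (2 * tau)
     * theta_const (1 + (a - b) / 2) (a' - b') (2 * tau))%C.
Proof.
  intros Ht.
  assert (Ht2 : 0 < Im (2 * tau)%C) by (rewrite im_scal_l; lra).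
  set (f := fun p : Z * Z => (theta_term a' tau (IZR (fst p) + a / 2)
                              * theta_term b' tau (IZR (snd p) + b / 2))%C).
  apply (has_sum_unique (fun p => f (parity_join p))).
  - apply (has_sum_reindex parity_join parity_split f).
    + apply parity_join_split.
    + apply parity_split_join.
    + apply (has_sum_prod (fun m => theta_term a' tau (IZR m + a / 2))
                          (fun n => theta_term b' tau (IZR n + b / 2)));
        auto using theta_term_abs_bounded, theta_const_has_sum.
  - apply has_sum_sum.
    + eapply has_sum_ext; [|apply has_sum_prod;
        [apply theta_term_abs_bounded | apply theta_term_abs_bounded
        |apply theta_const_has_sum | apply theta_const_has_sum]; exact Ht2].
      intros [i j]. unfold f, theta_term. simpl fst. simpl snd.
      rewrite <- !cexp_plus. f_equal. rewrite plus_IZR, minus_IZR.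
      destruct tau as [u v]. c_eq.
    + eapply has_sum_ext; [|apply has_sum_prod;
        [apply theta_term_abs_bounded | apply theta_term_abs_bounded
        |apply theta_const_has_sum | apply theta_const_has_sum]; exact Ht2].
      intros [i j]. unfold f, theta_term. simpl fst. simpl snd.
      rewrite <- !cexp_plus. f_equal. rewrite !plus_IZR, minus_IZR.
      destruct tau as [u v]. c_eq.
Qed.

(** * Weierstrass' three-term relation *)

(* The characteristic is centred at the odd one [1;1], where theta vanishes. *)
Definition theta_odd (tau : C) (x x' : R) : C := theta_const (1 + x) (1 + x') tau.

Definition theta_det (tau : C) (x x' y y' : R) : C :=
  (theta_const (1 + x) (2 * x') (2 * tau) * theta_const y (2 * y') (2 * tau)
   - theta_const x (2 * x') (2 * tau) * theta_const (1 + y) (2 * y') (2 * tau))%C.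

(** Removing the shift by 2 in the second characteristic costs ee(1 + x) = - ee x in one summand of
    [theta_const_mult] and ee x in the other. This opposite sign, an effect of the odd centre,
    produces a determinant. *)
Lemma theta_odd_mult tau x x' y y' : 0 < Im tau ->
  (theta_odd tau (x + y) (x' + y') * theta_odd tau (x - y) (x' - y'))%C =
  (- ee x * theta_det tau x x' y y')%C.
Proof.
  intros Ht.
  assert (Ht2 : 0 < Im (2 * tau)%C) by (rewrite im_scal_l; lra).
  unfold theta_odd. rewrite theta_const_mult by assumption.
  replace ((1 + (x + y) + (1 + (x - y))) / 2) with (1 + x) by field.
  replace ((1 + (x + y) - (1 + (x - y))) / 2) with y by field.
  replace (1 + (x' + y') + (1 + (x' - y'))) with (2 * x' + 2) by ring.
  replace (1 + (x' + y') - (1 + (x' - y'))) with (2 * y') by ring.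
  replace (1 + (1 + x)) with (x + 2) by ring.
  rewrite theta_const_plus2_l, !theta_const_plus2_r by assumption.
  rewrite ee_plus, ee_1. unfold theta_det. ring.
Qed.

(** The weights [ee w] and [ee z] give all three summands the common prefactor ee x * ee z * ee w.
    What remains is the Pluecker relation for the vectors at x, z, w and 0, a polynomial
    identity. *)
Lemma theta_odd_three_term tau x x' z z' w w' : 0 < Im tau ->
  (theta_odd tau x x' ^ 2
     * (theta_odd tau (z + w) (z' + w') * theta_odd tau (z - w) (z' - w')) * ee w
   + theta_odd tau w w' ^ 2
     * (theta_odd tau (x + z) (x' + z') * theta_odd tau (x - z) (x' - z')) * ee z
   - theta_odd tau z z' ^ 2
     * (theta_odd tau (x + w) (x' + w') * theta_odd tau (x - w) (x' - w')) * ee w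
   = 0)%C.
Proof.
  intros Ht.
  assert (S : forall u u', (theta_odd tau u u' ^ 2)%C = (- ee u * theta_det tau u u' 0 0)%C).
  { intros u u'. rewrite <- theta_odd_mult by assumption.
    rewrite !Rplus_0_r, !Rminus_0_r. simpl. ring. }
  rewrite !S, !theta_odd_mult by assumption. unfold theta_det. ring.
Qed.

(** * Specialisation to fifths: the two identities with cleared denominators *)

Lemma ee_zeta5 : zeta5 = ee (2 / 5).
Proof. unfold zeta5, ee. f_equal. c_eq. Qed.

Lemma Cmult_eq_reg_l (a b c : C) : a <> RtoC 0 -> (a * b)%C = (a * c)%C -> b = c.
Proof.
  intros Ha H. replace b with (/ a * (a * b))%C by (field; auto). rewrite H. field; auto.
Qed.

(** Evenness flips both characteristics, and the shift by 2 repairs the second one; this normalises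
    the characteristics that arise from the three-term relation. *)
Lemma theta_const_reflect e e' tau : 0 < Im tau ->
  (ee e * theta_const (- e) e' tau)%C = theta_const e (2 - e') tau.
Proof.
  intros Ht. replace (2 - e') with (- e' + 2) by ring.
  rewrite theta_const_plus2_r, <- (theta_const_opp e (- e')), Ropp_involutive by assumption.
  reflexivity.
Qed.

Lemma theta_const_reflect' e e' tau : 0 < Im tau ->
  theta_const (- e) e' tau = (ee (- e) * theta_const e (2 - e') tau)%C.
Proof.
  intros Ht. rewrite <- theta_const_reflect, Cmult_assoc, <- ee_plus by assumption.
  rewrite Rplus_opp_l, ee_0. ring.
Qed.

Lemma theta_relation_c3 tau : 0 < Im tau ->
  (theta_const 1 (1/5) tau * c_ 3 tau ^ 3 =
   - (zeta5 ^ 2) * (d_ 1 tau ^ 3 * c_ 5 tau + zeta5 ^ 3 * (d_ 7 tau ^ 3 * c_ 1 tau)))%C.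
Proof.
  intros Ht.
  (* Here x = z + w, so x - z = w and x - w = z produce the cubes; z - w = (0, 6/5) gives
     theta[1;11/5], that is - theta[1;1/5]. *)
  pose proof (theta_odd_three_term tau (-4/5) (-2/5) (-2/5) (2/5) (-2/5) (-4/5) Ht) as H.
  unfold theta_odd in H.
  replace (1 + (-2/5 - -2/5)) with 1 in H by field.
  replace (1 + (2/5 - -4/5)) with (1/5 + 2) in H by field.
  replace (1 + (-4/5 + -2/5)) with (- (1/5)) in H by field.
  rewrite theta_const_plus2_r, ee_1, (theta_const_reflect' (1/5) (1 + (-2/5 + 2/5))) in H
    by assumption.
  replace (1 + (-2/5 + -4/5)) with (- (1/5)) in H by field.
  rewrite theta_const_opp in H by assumption.
  replace (1 + -4/5) with (1/5) in H by field.
  replace (1 + -2/5) with (3/5) in H by field.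
  replace (1 + (-2/5 + -2/5)) with (1/5) in H by field.
  replace (1 + (2/5 + -4/5)) with (3/5) in H by field.
  replace (1 + (-4/5 - -2/5)) with (3/5) in H by field.
  replace (1 + (-2/5 - 2/5)) with (1/5) in H by field.
  replace (1 + (-2/5 - -4/5)) with (7/5) in H by field.
  replace (1 + 2/5) with (7/5) in H by field.
  replace (2 - (1 + (-2/5 + 2/5))) with (5/5) in H by field.
  assert (Z1 : (zeta5 ^ 2)%C = (- ee (- (1/5)))%C).
  { replace (- ee (- (1/5)))%C with (ee 1 * ee (- (1/5)))%C by (rewrite ee_1; ring).
    rewrite ee_zeta5. simpl. rewrite Cmult_1_r, <- !ee_plus. f_equal. field. }
  assert (Z2 : (zeta5 ^ 2 * zeta5 ^ 3)%C = RtoC 1).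
  { rewrite ee_zeta5. simpl. rewrite !Cmult_1_r, <- !ee_plus, <- (ee_2Z 1). f_equal. field. }
  unfold c_, d_.
  apply (Cmult_eq_reg_l (ee (-2/5))%C); [apply cexp_neq0|].
  (* [ee (-2/5)] is the weight shared by all three terms. Expanding the right-hand side exposes
     zeta5^2 * zeta5^3 = 1, which [ring] cannot know. *)
  transitivity (ee (-2/5) * (- zeta5 ^ 2
       * (theta_const (3/5) (1/5) tau ^ 3 * theta_const (1/5) (5/5) tau)
     - (zeta5 ^ 2 * zeta5 ^ 3)
       * (theta_const (3/5) (7/5) tau ^ 3 * theta_const (1/5) (1/5) tau)))%C;
    [|ring].
  rewrite Z2, Z1. symmetry. apply Ceq_minus. rewrite <- H. ring.
Qed.

Lemma theta_relation_d9 tau : 0 < Im tau ->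
  (theta_const 1 (3/5) tau * d_ 9 tau ^ 3 =
   - (zeta5 ^ 3) * (c_ 7 tau ^ 3 * d_ 5 tau - c_ 9 tau ^ 3 * d_ 3 tau))%C.
Proof.
  intros Ht.
  (* Here x + z + w = (-2, 2), so the sums of two points are the negatives of the third modulo 2 and
     produce the cubes; z - w = (0, -2/5) gives theta[1;3/5]. *)
  pose proof (theta_odd_three_term tau (-2/5) (4/5) (-4/5) (2/5) (-4/5) (4/5) Ht) as H.
  unfold theta_odd in H.
  replace (1 + (-4/5 - -4/5)) with 1 in H by field.
  replace (1 + (2/5 - 4/5)) with (3/5) in H by field.
  replace (1 + (-4/5 + -4/5)) with (- (3/5)) in H by field.
  replace (1 + (-2/5 + -4/5)) with (- (1/5)) in H by field.
  replace (1 + (-2/5 - -4/5)) with (- (3/5) + 2) in H by field.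
  rewrite !theta_const_plus2_l, !(theta_const_reflect' (3/5)), !(theta_const_reflect' (1/5)) in H
    by assumption.
  replace (2 - (1 + (2/5 + 4/5))) with (9/5 - 2) in H by field.
  replace (2 - (1 + (4/5 + 2/5))) with (9/5 - 2) in H by field.
  replace (2 - (1 + (4/5 + 4/5))) with (7/5 - 2) in H by field.
  replace (2 - (1 + (4/5 - 2/5))) with (3/5) in H by field.
  replace (2 - (1 + (4/5 - 4/5))) with (5/5) in H by field.
  assert (M : forall e e', theta_const e (e' - 2) tau = (ee (- e) * theta_const e e' tau)%C).
  { intros e e'. replace e' with (e' - 2 + 2) at 2 by ring.
    rewrite theta_const_plus2_r, Cmult_assoc, <- ee_plus, Rplus_opp_l, ee_0 by assumption. ring. }
  rewrite !M in H.
  replace (1 + -4/5) with (1/5) in H by field.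
  replace (1 + -2/5) with (3/5) in H by field.
  replace (1 + 2/5) with (7/5) in H by field.
  replace (1 + 4/5) with (9/5) in H by field.
  assert (Z1 : (zeta5 ^ 3 * ee (- (1/5)) = - RtoC 1)%C).
  { rewrite ee_zeta5. simpl. rewrite Cmult_1_r, <- !ee_plus, <- ee_1. f_equal. field. }
  assert (Z3 : ee (- (3/5)) = (ee (- (1/5)) * ee (- (1/5)) * ee (- (1/5)))%C).
  { rewrite <- !ee_plus. f_equal. field. }
  unfold c_, d_. rewrite Z3 in H.
  set (u := ee (- (1/5))) in *.
  assert (U0 : u <> RtoC 0) by apply cexp_neq0.
  (* Besides the common weight [ee (-4/5)], normalising the characteristics costs u^6 in the term
     with theta[1;3/5] and u^5 in the other two. The discrepancy u is the inverse of - zeta5^3, by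
     [Z1]. *)
  apply (Cmult_eq_reg_l (ee (-4/5) * u ^ 5 * u)%C).
  { apply Cmult_neq_0; [apply Cmult_neq_0; [apply cexp_neq0 | now apply Cpow_nz] | exact U0]. }
  transitivity (ee (-4/5) * u ^ 5 * (- (zeta5 ^ 3 * u) *
     (theta_const (1/5) (7/5) tau ^ 3 * theta_const (3/5) (5/5) tau
      - theta_const (1/5) (9/5) tau ^ 3 * theta_const (3/5) (3/5) tau)))%C; [|ring].
  rewrite Z1. apply Ceq_minus. rewrite <- H. ring.
Qed.

(** * Finite Jacobi triple product *)

Fixpoint cprod (u : nat -> C) (n : nat) : C :=
  match n with
  | O => RtoC 1
  | S n => (cprod u n * u n)%C
  end.

Lemma cprod_ext u v n : (forall k, u k = v k) -> cprod u n = cprod v n.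
Proof. intros H. induction n as [|n IH]; simpl; [reflexivity | now rewrite IH, H]. Qed.

Lemma cprod_add u m n : cprod u (m + n) = (cprod u m * cprod (fun k => u (m + k)%nat) n)%C.
Proof.
  induction n as [|n IH]; simpl.
  - rewrite Nat.add_0_r. ring.
  - rewrite Nat.add_succ_r. simpl. rewrite IH. ring.
Qed.

Definition qpoch (Q : C) (m : nat) : C := cprod (fun k => 1 - Q ^ S k)%C m.

(** The Gaussian binomial coefficient, by the q-Pascal rule to avoid division. Where [M - j] is
    truncated, it multiplies a vanishing coefficient. *)
Fixpoint qbinom (Q : C) (M j : nat) : C :=
  match M, j with
  | _, O => RtoC 1
  | O, S _ => RtoC 0
  | S M, S j => (qbinom Q M (S j) + Q ^ (M - j) * qbinom Q M j)%C
  end.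

(* [Q ^ (j * (j - 1) / 2)] *)
Fixpoint qtri (Q : C) (j : nat) : C :=
  match j with
  | O => RtoC 1
  | S j => (qtri Q j * Q ^ j)%C
  end.

Lemma qbinom_0 Q M : qbinom Q M 0 = RtoC 1.
Proof. now destruct M. Qed.

Lemma qbinom_gt Q M j : (M < j)%nat -> qbinom Q M j = RtoC 0.
Proof.
  revert j. induction M as [|M IH]; intros [|j] H; try lia; [reflexivity|].
  simpl. rewrite !IH by lia. ring.
Qed.

Lemma qbinom_diag Q M : qbinom Q M M = RtoC 1.
Proof.
  induction M as [|M IH]; [reflexivity|].
  simpl. rewrite qbinom_gt, IH, Nat.sub_diag by lia. simpl. ring.
Qed.

Lemma lsum_seq_head (f : nat -> C) n :
  lsum f (seq 0 (S n)) = (f 0%nat + lsum (fun j => f (S j)) (seq 0 n))%C.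
Proof. rewrite <- (lsum_map S f), seq_shift. reflexivity. Qed.

(** In the induction, the two terms of the new factor 1 + x Q^M correspond to the two terms of the
    q-Pascal rule. *)
Lemma qbinomial Q x M :
  cprod (fun k => 1 + x * Q ^ k)%C M =
  lsum (fun j => qbinom Q M j * (qtri Q j * x ^ j))%C (seq 0 (S M)).
Proof.
  induction M as [|M IH]; [simpl; ring|].
  set (t := fun j => (qtri Q j * x ^ j)%C).
  assert (E : lsum (fun j => qbinom Q (S M) j * t j)%C (seq 0 (S (S M))) =
    (lsum (fun j => qbinom Q M j * t j) (seq 0 (S (S M)))
     + x * Q ^ M * lsum (fun j => qbinom Q M j * t j) (seq 0 (S M)))%C).
  { rewrite !(lsum_seq_head _ (S M)), !qbinom_0, <- lsum_scal, <- Cplus_assoc, <- lsum_plus.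
    f_equal. apply lsum_ext_in. intros j Hj. apply in_seq in Hj.
    unfold t. simpl qbinom. simpl qtri. rewrite Cpow_S.
    replace (Q ^ M)%C with (Q ^ (M - j) * Q ^ j)%C by (rewrite <- Cpow_add_r; f_equal; lia).
    ring. }
  unfold t in E. cbn [cprod]. rewrite IH, E, (seq_S (S M)), lsum_app.
  simpl (lsum _ (_ :: nil)). rewrite qbinom_gt by lia. ring.
Qed.

(** The quotient formula for the Gaussian binomial, multiplied out so as to hold for every Q. The
    induction rests on 1 - Q^(a+b) = (1 - Q^a) + Q^a (1 - Q^b). *)
Lemma qbinom_qpoch Q j k :
  (qbinom Q (j + k) j * (qpoch Q j * qpoch Q k))%C = qpoch Q (j + k).
Proof.
  remember (j + k)%nat as n eqn:E. revert j k E.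
  induction n as [|n IH]; intros j k E.
  - replace j with 0%nat by lia. replace k with 0%nat by lia. simpl. unfold qpoch; simpl. ring.
  - destruct j as [|j]; [|destruct k as [|k]].
    + replace k with (S n) by lia. rewrite qbinom_0. unfold qpoch at 1; simpl cprod. ring.
    + replace (S j) with (S n) by lia. rewrite qbinom_diag.
      replace (qpoch Q 0) with (RtoC 1) by reflexivity. ring.
    + pose proof (IH (S j) k ltac:(lia)) as H1. pose proof (IH j (S k) ltac:(lia)) as H2.
      assert (R : forall m, qpoch Q (S m) = (qpoch Q m * (1 - Q ^ S m))%C) by reflexivity.
      change (qbinom Q (S n) (S j)) with (qbinom Q n (S j) + Q ^ (n - j) * qbinom Q n j)%C.
      transitivity ((qbinom Q n (S j) * (qpoch Q (S j) * qpoch Q k)) * (1 - Q ^ S k)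
        + Q ^ (n - j) * (1 - Q ^ S j) * (qbinom Q n j * (qpoch Q j * qpoch Q (S k))))%C.
      * rewrite !R. ring.
      * rewrite H1, H2, R. replace (n - j)%nat with (S k) by lia.
        replace (Q ^ S n)%C with (Q ^ S k * Q ^ S j)%C by (rewrite <- Cpow_add_r; f_equal; lia).
        ring.
Qed.

Lemma cexp_pow z n : (cexp z ^ n)%C = cexp (RtoC (INR n) * z)%C.
Proof.
  induction n as [|n IH].
  - simpl. rewrite <- cexp_0. f_equal. ring.
  - rewrite Cpow_S, IH, S_INR, RtoC_plus, <- cexp_plus. f_equal. ring.
Qed.

Definition theta_nth (e e' : R) (tau : C) (n : Z) : C := theta_term e' tau (IZR n + e / 2).

Definition nome2 (tau : C) : C := cexp (ipi * (2 * tau))%C.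

(** The quotient of the summands at n + 1 and n; it is geometric in n with ratio [nome2 tau]. *)
Definition theta_ratio (e e' : R) (tau : C) (n : Z) : C :=
  cexp (ipi * (RtoC (e + 1 + 2 * IZR n) * tau + RtoC e'))%C.

Lemma theta_nth_succ e e' tau n :
  theta_nth e e' tau (n + 1) = (theta_nth e e' tau n * theta_ratio e e' tau n)%C.
Proof.
  unfold theta_nth, theta_term, theta_ratio. rewrite <- cexp_plus, plus_IZR. f_equal.
  destruct tau as [u v]. c_eq.
Qed.

Lemma theta_ratio_add e e' tau n (k : nat) :
  theta_ratio e e' tau (n + Z.of_nat k) = (theta_ratio e e' tau n * nome2 tau ^ k)%C.
Proof.
  unfold theta_ratio, nome2. rewrite cexp_pow, <- cexp_plus, plus_IZR, INR_IZR_INZ. f_equal.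
  destruct tau as [u v]. c_eq.
Qed.

Lemma theta_nth_qtri e e' tau n (j : nat) :
  theta_nth e e' tau (n + Z.of_nat j) =
  (theta_nth e e' tau n * (qtri (nome2 tau) j * theta_ratio e e' tau n ^ j))%C.
Proof.
  induction j as [|j IH].
  - simpl. rewrite Z.add_0_r. ring.
  - replace (n + Z.of_nat (S j))%Z with (n + Z.of_nat j + 1)%Z by lia.
    rewrite theta_nth_succ, IH, theta_ratio_add, Cpow_S. simpl. ring.
Qed.

(** Far to the left the ratios rho_m are large. Writing T_m for the summand, T_m (1 + rho_m) =
    T_(m+1) (1 + 1/rho_m) trades each such factor for one close to 1 while the prefactor moves from
    index -N to 0. *)
Lemma theta_nth_negative_factors e e' tau (N : nat) :
  (theta_nth e e' tau (- Z.of_nat N)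
   * cprod (fun k => 1 + theta_ratio e e' tau (- Z.of_nat N) * nome2 tau ^ k) N)%C =
  (theta_nth e e' tau 0 * cprod (fun k => 1 + / theta_ratio e e' tau (-1) * nome2 tau ^ k) N)%C.
Proof.
  assert (H0 : forall n, theta_ratio e e' tau n <> RtoC 0) by (intros; apply cexp_neq0).
  induction N as [|N IH]; [simpl; ring|].
  set (m := (- Z.of_nat (S N))%Z).
  rewrite (cprod_add _ 1 N). cbn [cprod].
  rewrite (cprod_ext _ (fun k => 1 + theta_ratio e e' tau (- Z.of_nat N) * nome2 tau ^ k)%C).
  2: { intros k. rewrite Nat.add_1_l, <- !theta_ratio_add. do 2 f_equal. unfold m. lia. }
  transitivity ((theta_nth e e' tau m + theta_nth e e' tau m * theta_ratio e e' tau m)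
    * cprod (fun k => 1 + theta_ratio e e' tau (- Z.of_nat N) * nome2 tau ^ k) N)%C; [simpl; ring|].
  rewrite <- theta_nth_succ. replace (m + 1)%Z with (- Z.of_nat N)%Z by (unfold m; lia).
  transitivity (theta_nth e e' tau (- Z.of_nat N)
    * cprod (fun k => 1 + theta_ratio e e' tau (- Z.of_nat N) * nome2 tau ^ k) N
    * (1 + / theta_ratio e e' tau m))%C.
  - replace (- Z.of_nat N)%Z with (m + 1)%Z by (unfold m; lia).
    rewrite theta_nth_succ. field. apply H0.
  - rewrite IH.
    replace (/ theta_ratio e e' tau m)%C with (/ theta_ratio e e' tau (-1) * nome2 tau ^ N)%C; [ring|].
    assert (E : (theta_ratio e e' tau m * nome2 tau ^ N)%C = theta_ratio e e' tau (-1)).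
    { rewrite <- theta_ratio_add. f_equal. unfold m. lia. }
    rewrite <- E. field. split; [apply H0|]. apply Cpow_nz, cexp_neq0.
Qed.

Lemma finite_triple_product e e' tau (N : nat) :
  lsum (fun j => theta_nth e e' tau (- Z.of_nat N + Z.of_nat j) * qbinom (nome2 tau) (2 * N) j)%C
    (seq 0 (S (2 * N))) =
  (theta_nth e e' tau 0 * cprod (fun k => 1 + theta_ratio e e' tau 0 * nome2 tau ^ k) N
       * cprod (fun k => 1 + / theta_ratio e e' tau (-1) * nome2 tau ^ k) N)%C.
Proof.
  set (m := (- Z.of_nat N)%Z).
  rewrite (lsum_ext_in _ (fun j => theta_nth e e' tau m
    * (qbinom (nome2 tau) (2 * N) j * (qtri (nome2 tau) j * theta_ratio e e' tau m ^ j)))%C).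
  2: { intros j _. rewrite theta_nth_qtri. ring. }
  (* The first N of the 2N factors have ratios at negative indices and are inverted; the last N
     already start from the ratio at 0. *)
  rewrite lsum_scal, <- qbinomial. replace (2 * N)%nat with (N + N)%nat by lia.
  rewrite cprod_add, Cmult_assoc. unfold m at 1 2. rewrite theta_nth_negative_factors.
  rewrite (cprod_ext (fun k => 1 + theta_ratio e e' tau m * nome2 tau ^ (N + k))%C
             (fun k => 1 + theta_ratio e e' tau 0 * nome2 tau ^ k)%C); [ring|].
  intros k. rewrite <- !theta_ratio_add. do 2 f_equal. unfold m. lia.
Qed.

(** * Non-vanishing of theta constants *)

Lemma Cmod_cprod_le u K r N : 0 <= r < 1 -> 0 <= K -> (forall k, Cmod (u k) <= K * r ^ k) ->
  Cmod (cprod (fun k => 1 + u k)%C N) <= exp (K * / (1 - r)).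
Proof.
  intros Hr HK Hu.
  apply Rle_trans with (exp (K * rsum (fun k => r ^ k) (seq 0 N))).
  - induction N as [|N IH].
    + simpl. rewrite Cmod_1, Rmult_0_r, exp_0. lra.
    + rewrite seq_S, rsum_app, Rmult_plus_distr_l, exp_plus. cbn [cprod].
      rewrite Cmod_mult. apply Rmult_le_compat; auto using Cmod_ge_0.
      simpl. rewrite Rplus_0_r.
      eapply Rle_trans; [apply Cmod_triangle|]. rewrite Cmod_1.
      eapply Rle_trans; [apply Rplus_le_compat_l, Hu|]. apply exp_ineq1_le.
  - apply exp_le_compat, Rmult_le_compat_l; auto. now apply rsum_geom_le.
Qed.

Lemma exp_opp_le_one_minus x : 0 <= x <= 1 / 2 -> exp (- (2 * x)) <= 1 - x.
Proof.
  intros Hx. rewrite exp_Ropp.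
  assert (1 + 2 * x <= exp (2 * x)) by apply exp_ineq1_le.
  apply Rle_trans with (/ (1 + 2 * x)).
  - apply Rinv_le_contravar; lra.
  - apply Rmult_le_reg_l with (1 + 2 * x); [lra|]. rewrite Rinv_r by lra. nra.
Qed.

(** Up to [k0] there are finitely many nonzero partial products, which have a positive minimum.
    Beyond it |u k| <= 1/2, so [exp_opp_le_one_minus] bounds the rest below by the exponential of a
    convergent geometric sum. *)
Lemma Cmod_cprod_ge u K r : 0 <= r < 1 -> 0 <= K -> (forall k, Cmod (u k) <= K * r ^ k) ->
  (forall k, (1 + u k)%C <> RtoC 0) ->
  exists b, 0 < b /\ forall N, b <= Cmod (cprod (fun k => 1 + u k)%C N).
Proof.
  intros Hr HK Hu H0.
  assert (P0 : forall N, 0 < Cmod (cprod (fun k => 1 + u k)%C N)).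
  { intros N. apply Cmod_gt_0. induction N as [|N IH]; simpl.
    - intros E. injection E. lra.
    - now apply Cmult_neq_0. }
  assert (Hk : exists k0, forall k, (k0 <= k)%nat -> K * r ^ k <= 1 / 2).
  (* [K + 1] instead of [K] allows for K = 0. *)
  { destruct (pow_lt_1_zero r) with (y := / (2 * (K + 1))) as [k0 H].
    - rewrite Rabs_pos_eq; lra.
    - apply Rinv_0_lt_compat. lra.
    - exists k0. intros k hk. specialize (H k hk).
      rewrite Rabs_pos_eq in H by (apply pow_le; lra).
      assert (r ^ k * (2 * (K + 1)) < 1).
      { apply Rmult_lt_reg_r with (/ (2 * (K + 1))); [apply Rinv_0_lt_compat; lra|].
        rewrite Rmult_assoc, Rinv_r by lra. lra. }
      pose proof (pow_le r k (proj1 Hr)). nra. }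
  destruct Hk as [k0 Hk].
  assert (F : forall m, exists b, 0 < b /\
    forall N, (N <= m)%nat -> b <= Cmod (cprod (fun k => 1 + u k)%C N)).
  { induction m as [|m [b [Hb IH]]].
    - exists 1. split; [lra|]. intros N HN. replace N with 0%nat by lia. simpl. rewrite Cmod_1. lra.
    - exists (Rmin b (Cmod (cprod (fun k => 1 + u k)%C (S m)))). split; [now apply Rmin_pos|].
      intros N HN. destruct (Nat.eq_dec N (S m)) as [E|E].
      + rewrite E. apply Rmin_r.
      + eapply Rle_trans; [apply Rmin_l | apply IH; lia]. }
  destruct (F k0) as [b [Hb F0]].
  set (c := Cmod (cprod (fun k => 1 + u k)%C k0)).
  assert (G : forall n, c * exp (- (2 * (K * rsum (fun k => r ^ k) (seq 0 n))))
                        <= Cmod (cprod (fun k => 1 + u k)%C (k0 + n))).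
  { induction n as [|n IH].
    - rewrite Nat.add_0_r. simpl. rewrite !Rmult_0_r, Ropp_0, exp_0. unfold c. lra.
    - rewrite Nat.add_succ_r. cbn [cprod]. rewrite Cmod_mult, seq_S, rsum_app.
      cbn [rsum fold_right Nat.add]. rewrite Rplus_0_r.
      replace (- (2 * (K * (rsum (fun k => r ^ k) (seq 0 n) + r ^ n))))
        with (- (2 * (K * rsum (fun k => r ^ k) (seq 0 n))) + - (2 * (K * r ^ n))) by ring.
      rewrite exp_plus, <- Rmult_assoc.
      apply Rmult_le_compat; auto.
      + apply Rmult_le_pos; [unfold c; apply Cmod_ge_0 | left; apply exp_pos].
      + left; apply exp_pos.
      + set (x := K * r ^ (k0 + n)). assert (Hx : x <= 1 / 2) by (apply Hk; lia).
        assert (Hx0 : 0 <= x) by (apply Rmult_le_pos; auto; apply pow_le; lra).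
        assert (Hxn : x <= K * r ^ n).
        { unfold x. apply Rmult_le_compat_l; auto. rewrite pow_add.
          assert (r ^ k0 <= 1) by (rewrite <- (pow1 k0); apply pow_incr; lra).
          pose proof (pow_le r n (proj1 Hr)). nra. }
        apply Rle_trans with (exp (- (2 * x))); [apply exp_le_compat; lra|].
        eapply Rle_trans; [apply exp_opp_le_one_minus; lra|].
        assert (Cmod (RtoC 1) <= Cmod (1 + u (k0 + n)%nat) + Cmod (- u (k0 + n)%nat)).
        { eapply Rle_trans; [|apply Cmod_triangle]. right. f_equal. ring. }
        rewrite Cmod_1, Cmod_opp in H. specialize (Hu (k0 + n)%nat). fold x in Hu. lra. }
  set (d := c * exp (- (2 * (K * / (1 - r))))).
  exists (Rmin b d). split.
  { apply Rmin_pos; auto. apply Rmult_lt_0_compat; [apply P0 | apply exp_pos]. }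
  intros N. destruct (le_lt_dec N k0) as [h|h].
  - eapply Rle_trans; [apply Rmin_l | now apply F0].
  - replace N with (k0 + (N - k0))%nat by lia.
    eapply Rle_trans; [apply Rmin_r|]. eapply Rle_trans; [|apply G].
    apply Rmult_le_compat_l; [unfold c; apply Cmod_ge_0|]. apply exp_le_compat.
    pose proof (Rmult_le_compat_l K _ _ HK (rsum_geom_le r (N - k0) Hr)). lra.
Qed.

Lemma one_plus_neq0 (x : C) : Cmod x < 1 -> (1 + x)%C <> RtoC 0.
Proof.
  intros H E. assert (x = - RtoC 1)%C.
  { replace x with ((1 + x) - 1)%C by ring. rewrite E. ring. }
  subst x. rewrite Cmod_opp, Cmod_1 in H. lra.
Qed.

(** * Bounds for q-Pochhammer symbols and Gaussian binomials *)

Lemma qpoch_bounds Q : Cmod Q < 1 ->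
  exists b B, 0 < b /\ forall m, b <= Cmod (qpoch Q m) <= B.
Proof.
  intros HQ. pose proof (Cmod_ge_0 Q) as HQ0.
  assert (E : forall m, qpoch Q m = cprod (fun k => 1 + - Q ^ S k)%C m).
  { intros m. apply cprod_ext. intros k. ring. }
  assert (Hu : forall k, Cmod (- Q ^ S k) <= 1 * Cmod Q ^ k).
  { intros k. rewrite Cmod_opp, Cmod_pow. simpl. pose proof (pow_le _ k HQ0). nra. }
  destruct (Cmod_cprod_ge (fun k => - Q ^ S k)%C 1 (Cmod Q)) as [b [Hb Hb']]; try lra; auto.
  { intros k. apply one_plus_neq0. rewrite Cmod_opp, Cmod_pow. simpl.
    assert (Cmod Q ^ k <= 1) by (rewrite <- (pow1 k); apply pow_incr; lra).
    pose proof (pow_le _ k HQ0). nra. }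
  exists b, (exp (1 * / (1 - Cmod Q))). split; auto. intros m. rewrite E. split; auto.
  apply Cmod_cprod_le; auto; lra.
Qed.

Lemma qpoch_cauchy Q B m k : Cmod Q < 1 -> (forall m, Cmod (qpoch Q m) <= B) ->
  Cmod (qpoch Q (m + k) - qpoch Q m) <= B * / (1 - Cmod Q) * Cmod Q ^ m.
Proof.
  intros HQ HB. set (r := Cmod Q) in *.
  assert (Hr : 0 <= r < 1) by (split; [apply Cmod_ge_0 | auto]).
  assert (HB0 : 0 <= B) by (eapply Rle_trans; [apply Cmod_ge_0 | apply (HB 0%nat)]).
  pose proof (pow_le r m (proj1 Hr)) as Hm.
  apply Rle_trans with (B * rsum (fun i => r ^ i) (seq 0 k) * r ^ m).
  - induction k as [|k IH].
    + rewrite Nat.add_0_r. simpl. replace (qpoch Q m - qpoch Q m)%C with (RtoC 0) by ring.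
      rewrite Cmod_0. lra.
    + rewrite Nat.add_succ_r, seq_S, rsum_app. cbn [rsum fold_right Nat.add].
      change (qpoch Q (S (m + k))) with (qpoch Q (m + k) * (1 - Q ^ S (m + k)))%C.
      replace (qpoch Q (m + k) * (1 - Q ^ S (m + k)) - qpoch Q m)%C with
        ((qpoch Q (m + k) - qpoch Q m) + - (qpoch Q (m + k) * Q ^ S (m + k)))%C by ring.
      eapply Rle_trans; [apply Cmod_triangle|].
      rewrite Cmod_opp, Cmod_mult, Cmod_pow. fold r.
      assert (Cmod (qpoch Q (m + k)) * r ^ S (m + k) <= B * (r ^ k * r ^ m)); [|lra].
      apply Rmult_le_compat; auto using Cmod_ge_0; [apply pow_le; lra|].
      rewrite <- pow_add, (Nat.add_comm k m). simpl.
      pose proof (pow_le r (m + k) (proj1 Hr)). nra.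
  - apply Rmult_le_compat_r; auto. apply Rmult_le_compat_l; auto. now apply rsum_geom_le.
Qed.

Lemma qpoch_dist Q B a b n : Cmod Q < 1 -> (forall m, Cmod (qpoch Q m) <= B) ->
  (n <= a)%nat -> (n <= b)%nat ->
  Cmod (qpoch Q a - qpoch Q b) <= B * / (1 - Cmod Q) * Cmod Q ^ n.
Proof.
  intros HQ HB.
  assert (W : forall a b, (n <= a)%nat -> (a <= b)%nat ->
    Cmod (qpoch Q b - qpoch Q a) <= B * / (1 - Cmod Q) * Cmod Q ^ n).
  { clear a b. intros a b Ha Hb. replace b with (a + (b - a))%nat by lia.
    eapply Rle_trans; [now apply qpoch_cauchy|].
    assert (0 <= B) by (eapply Rle_trans; [apply Cmod_ge_0 | apply (HB 0%nat)]).
    apply Rmult_le_compat_l.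
    - apply Rmult_le_pos; auto. left. apply Rinv_0_lt_compat. lra.
    - replace a with (n + (a - n))%nat by lia. rewrite pow_add.
      pose proof (Cmod_ge_0 Q).
      assert (Cmod Q ^ (a - n) <= 1) by (rewrite <- (pow1 (a - n)); apply pow_incr; lra).
      pose proof (pow_le (Cmod Q) n H0). nra. }
  intros Ha Hb. destruct (le_lt_dec a b).
  - rewrite Cmod_sub_sym. apply W; auto.
  - apply W; auto; lia.
Qed.

(* Clearing denominators in [qbinom Q (2N) j * (qpoch N)^2 / qpoch (2N) -> 1]. *)
Lemma qbinom_central_dist Q b B N j n : Cmod Q < 1 -> 0 < b ->
  (forall m, b <= Cmod (qpoch Q m) <= B) ->
  (j <= 2 * N)%nat -> (n <= N)%nat -> (n <= j)%nat -> (n <= 2 * N - j)%nat ->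
  Cmod (qbinom Q (2 * N) j * qpoch Q N ^ 2 - qpoch Q (2 * N))
  <= 2 * B ^ 3 * / (1 - Cmod Q) * / b ^ 2 * Cmod Q ^ n.
Proof.
  intros HQ Hb HB Hj h1 h2 h3.
  assert (HB' : forall m, Cmod (qpoch Q m) <= B) by (intros; apply HB).
  assert (HB0 : 0 < B) by (pose proof (HB 0%nat); lra).
  set (j' := (2 * N - j)%nat) in *.
  pose proof (qbinom_qpoch Q j j') as H.
  replace (j + j')%nat with (2 * N)%nat in H by (unfold j'; lia).
  set (X := (qbinom Q (2 * N) j * qpoch Q N ^ 2 - qpoch Q (2 * N))%C).
  (* By [qbinom_qpoch] the left side is qpoch(2N) times qpoch(N)^2 - qpoch(j) qpoch(j'), here
     written through differences that [qpoch_dist] controls. *)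
  assert (E : (X * (qpoch Q j * qpoch Q j'))%C =
    (qpoch Q (2 * N) * (qpoch Q N * (qpoch Q N - qpoch Q j) + qpoch Q j * (qpoch Q N - qpoch Q j')))%C).
  { transitivity ((qbinom Q (2 * N) j * (qpoch Q j * qpoch Q j')) * qpoch Q N ^ 2
      - qpoch Q (2 * N) * (qpoch Q j * qpoch Q j'))%C; [unfold X; ring|].
    rewrite H. ring. }
  apply (f_equal Cmod) in E. rewrite !Cmod_mult in E.
  pose proof (qpoch_dist Q B N j n HQ HB' h1 h2) as D1.
  pose proof (qpoch_dist Q B N j' n HQ HB' h1 h3) as D2.
  set (Y := B * / (1 - Cmod Q) * Cmod Q ^ n) in *.
  assert (R : Cmod (qpoch Q (2 * N)) * Cmod (qpoch Q N * (qpoch Q N - qpoch Q j)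
       + qpoch Q j * (qpoch Q N - qpoch Q j')) <= B * (B * Y + B * Y)).
  { apply Rmult_le_compat; auto using Cmod_ge_0.
    eapply Rle_trans; [apply Cmod_triangle|]. rewrite !Cmod_mult.
    apply Rplus_le_compat; apply Rmult_le_compat; auto using Cmod_ge_0. }
  rewrite <- E in R.
  pose proof (HB j) as [bj _]. pose proof (HB j') as [bj' _].
  assert (L : Cmod X * b ^ 2 <= Cmod X * (Cmod (qpoch Q j) * Cmod (qpoch Q j'))).
  { apply Rmult_le_compat_l; [apply Cmod_ge_0|]. nra. }
  assert (b2 : 0 < b ^ 2) by (apply pow_lt; auto).
  apply Rmult_le_reg_r with (b ^ 2); auto.
  replace (2 * B ^ 3 * / (1 - Cmod Q) * / b ^ 2 * Cmod Q ^ n * b ^ 2) with (B * (B * Y + B * Y)).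
  - lra.
  - unfold Y. field. split; lra.
Qed.

(** * Limit of the weighted sums *)

Lemma lsum_shifted_box (T : Z -> C) (N : nat) :
  lsum (fun j => T (- Z.of_nat N + Z.of_nat j)%Z) (seq 0 (S (2 * N))) =
  (lsum T (zbox N) + T (Z.of_nat N))%C.
Proof.
  rewrite <- (lsum_map (fun j => (- Z.of_nat N + Z.of_nat j)%Z) T).
  rewrite (lsum_perm T _ (zbox N ++ (Z.of_nat N :: nil))).
  - rewrite lsum_app. simpl. ring.
  - apply NoDup_Permutation.
    + apply FinFun.Injective_map_NoDup; [intros x y E; lia | apply seq_NoDup].
    + apply NoDup_app; [apply NoDup_zbox | repeat constructor; intros [] |].
      intros x Hx [E|[]]. apply in_zbox in Hx. lia.
    + intros x. rewrite in_app_iff, in_zbox, in_map_iff. split.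
      * intros [j [E Hj]]. apply in_seq in Hj. simpl. lia.
      * intros Hx. exists (Z.to_nat (x + Z.of_nat N)). rewrite in_seq. simpl in Hx. lia.
Qed.

Lemma rsum_const x m : rsum (fun _ => x) (seq 0 m) = INR m * x.
Proof.
  induction m as [|m IH]; [simpl; ring|].
  rewrite seq_S, rsum_app, IH, S_INR. simpl. ring.
Qed.

Lemma INR_mult_pow_le s N : 0 <= s < 1 -> INR (S N) * s ^ N <= / (1 - s).
Proof.
  intros Hs. apply Rle_trans with (rsum (fun k => s ^ k) (seq 0 (S N))).
  2: now apply rsum_geom_le.
  rewrite <- rsum_const. apply rsum_le_in. intros i Hi. apply in_seq in Hi.
  replace N with (i + (N - i))%nat by lia. rewrite pow_add.
  assert (s ^ (N - i) <= 1) by (rewrite <- (pow1 (N - i)); apply pow_incr; lra).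
  pose proof (pow_le s i (proj1 Hs)). nra.
Qed.

(** With r = s^2, one factor s^N keeps (N+1) s^N bounded and the other drives the product to 0. *)
Lemma INR_mult_pow_cvg0 K r : 0 <= r < 1 -> 0 <= K -> forall eps, 0 < eps ->
  exists N0, forall N, (N0 <= N)%nat -> K * (INR (S N) * r ^ N) < eps.
Proof.
  intros Hr HK eps He. set (s := sqrt r).
  assert (Hs : 0 <= s < 1).
  { split; [apply sqrt_pos|]. unfold s. rewrite <- sqrt_1. apply sqrt_lt_1; lra. }
  assert (Es : r = s * s) by (unfold s; now rewrite sqrt_sqrt).
  set (A := K * / (1 - s)).
  assert (HA : 0 <= A) by (apply Rmult_le_pos; auto; left; apply Rinv_0_lt_compat; lra).
  destruct (pow_lt_1_zero s) with (y := eps / (A + 1)) as [N0 H].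
  - rewrite Rabs_pos_eq; lra.
  - apply Rdiv_lt_0_compat; lra.
  - exists N0. intros N HN. specialize (H N HN).
    pose proof (pow_le s N (proj1 Hs)). rewrite Rabs_pos_eq in H by auto.
    rewrite Es, Rpow_mult_distr.
    apply Rle_lt_trans with (A * s ^ N).
    + unfold A. replace (K * (INR (S N) * (s ^ N * s ^ N)))
        with (K * (INR (S N) * s ^ N) * s ^ N) by ring.
      apply Rmult_le_compat_r; auto. apply Rmult_le_compat_l; auto. now apply INR_mult_pow_le.
    + apply Rle_lt_trans with (A * (eps / (A + 1))).
      * apply Rmult_le_compat_l; lra.
      * replace eps with (eps / (A + 1) * (A + 1)) at 2 by (field; lra).
        assert (0 < eps / (A + 1)) by (apply Rdiv_lt_0_compat; lra). nra.
Qed.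

Lemma exp_opp_lt_1 x : 0 < x -> exp (- x) < 1.
Proof. intros H. rewrite <- exp_0. apply exp_increasing. lra. Qed.

Lemma theta_const_neq0 e e' tau : 0 < Im tau -> -1 < e < 1 -> theta_const e e' tau <> RtoC 0.
Proof.
  intros Ht He Hz.
  set (T := theta_nth e e' tau). set (Q := nome2 tau). set (r := Cmod Q).
  assert (Hpi : 0 < PI * Im tau) by (apply Rmult_lt_0_compat; auto; apply PI_RGT_0).
  assert (Hr : 0 < r < 1).
  { unfold r, Q, nome2. rewrite Cmod_cexp.
    replace (Re (ipi * (2 * tau))%C) with (- (2 * (PI * Im tau)))
      by (destruct tau; unfold ipi; simpl; ring).
    split; [apply exp_pos | apply exp_opp_lt_1; lra]. }
  assert (Hr' : 0 <= r < 1) by lra.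
  destruct (qpoch_bounds Q (proj2 Hr)) as [b [B [Hb HB]]].
  assert (HB0 : 0 < B) by (pose proof (HB 0%nat); lra).
  assert (fac : forall x, Cmod x < 1 ->
    exists d, 0 < d /\ forall N, d <= Cmod (cprod (fun k => 1 + x * Q ^ k)%C N)).
  { intros x Hx. apply Cmod_cprod_ge with (K := 1) (r := r); try lra.
    - intros k. rewrite Cmod_mult, Cmod_pow. fold r. apply Rmult_le_compat_r; [apply pow_le|]; lra.
    - intros k. apply one_plus_neq0. rewrite Cmod_mult, Cmod_pow. fold r.
      assert (r ^ k <= 1) by (rewrite <- (pow1 k); apply pow_incr; lra).
      pose proof (pow_le r k (proj1 Hr')). pose proof (Cmod_ge_0 x). nra. }
  (* This is where |e| < 1 enters: -1 < e makes the ratio at 0 smaller than 1 in modulus, and e < 1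
     does so for the inverse ratio at -1. *)
  destruct (fac (theta_ratio e e' tau 0)) as [d1 [Hd1 F1]].
  { unfold theta_ratio. rewrite Cmod_cexp.
    match goal with |- exp ?a < 1 => replace a with (- ((1 + e) * (PI * Im tau)))
      by (destruct tau; unfold ipi; simpl; ring) end.
    apply exp_opp_lt_1. apply Rmult_lt_0_compat; lra. }
  destruct (fac (/ theta_ratio e e' tau (-1))%C) as [d2 [Hd2 F2]].
  { rewrite Cmod_inv by apply cexp_neq0. unfold theta_ratio. rewrite Cmod_cexp, <- exp_Ropp.
    match goal with |- exp ?a < 1 => replace a with (- ((1 - e) * (PI * Im tau)))
      by (destruct tau; unfold ipi; simpl; ring) end.
    apply exp_opp_lt_1. apply Rmult_lt_0_compat; lra. }
  assert (HT0 : 0 < Cmod (T 0%Z)) by (apply Cmod_gt_0; apply cexp_neq0).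
  set (dl := b ^ 2 * (Cmod (T 0%Z) * d1 * d2)).
  assert (Hdl : 0 < dl).
  { apply Rmult_lt_0_compat; [now apply pow_lt|]. repeat apply Rmult_lt_0_compat; auto. }
  destruct (theta_term_decay e e' tau r Ht Hr) as [K G]. change (geom_decay T K r) in G.
  pose proof (geom_decay_const_ge0 _ _ _ G) as HK.
  rewrite theta_const_zsum in Hz. change (zsum T = RtoC 0) in Hz.
  (* If the theta constant were 0, three errors of less than dl/4 each (box sum, end term, weights)
     would add up to a quantity bounded below by [dl]. *)
  destruct (zsum_cvg T K r G (dl / (4 * B))) as [N1 H1]; [apply Rdiv_lt_0_compat; lra|].
  set (D := 2 * B ^ 3 * / (1 - r) * / b ^ 2).
  assert (HD : 0 <= D).
  { unfold D. repeat apply Rmult_le_pos; try lra; try (apply pow_le; lra);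
      left; apply Rinv_0_lt_compat; try lra. now apply pow_lt. }
  destruct (INR_mult_pow_cvg0 (B * K) r Hr') with (eps := dl / 4) as [N2 H2];
    [apply Rmult_le_pos; lra | lra |].
  destruct (INR_mult_pow_cvg0 (2 * (K * D)) r Hr') with (eps := dl / 4) as [N3 H3];
    [apply Rmult_le_pos; [lra | now apply Rmult_le_pos] | lra |].
  set (N := Nat.max N1 (Nat.max N2 N3)).
  specialize (H1 N ltac:(lia)). specialize (H2 N ltac:(lia)). specialize (H3 N ltac:(lia)).
  rewrite Hz in H1. replace (lsum T (zbox N) - 0)%C with (lsum T (zbox N)) in H1 by ring.
  pose proof (finite_triple_product e e' tau N) as J. fold T Q in J.
  set (idx := fun j : nat => (- Z.of_nat N + Z.of_nat j)%Z) in *.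
  (* The product formula sums over -N..N, but [zbox N] stops at N - 1; the end term is estimated
     separately. *)
  assert (TN : Cmod (T (Z.of_nat N)) <= K * r ^ N) by now apply geom_decay_pos.
  assert (lower : dl <= Cmod (qpoch Q N ^ 2 *
     lsum (fun j => T (idx j) * qbinom Q (2 * N) j) (seq 0 (S (2 * N))))%C).
  { unfold idx. rewrite J, !Cmod_mult, Cmod_pow. unfold dl.
    pose proof (HB N) as [bN _].
    apply Rmult_le_compat; [apply pow_le; lra | | apply pow_incr; lra |].
    - repeat apply Rmult_le_pos; lra.
    - apply Rmult_le_compat; auto; [apply Rmult_le_pos; lra | lra |].
      apply Rmult_le_compat; auto; lra || apply Rle_refl. }
  assert (split : (qpoch Q N ^ 2 * lsum (fun j => T (idx j) * qbinom Q (2 * N) j)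
      (seq 0 (S (2 * N))))%C =
    (qpoch Q (2 * N) * (lsum T (zbox N) + T (Z.of_nat N))
     + lsum (fun j => T (idx j) * (qbinom Q (2 * N) j * qpoch Q N ^ 2 - qpoch Q (2 * N)))
         (seq 0 (S (2 * N))))%C).
  { rewrite <- lsum_shifted_box, <- !lsum_scal, <- lsum_plus. apply lsum_ext_in.
    intros j _. unfold idx. ring. }
  rewrite split in lower.
  assert (U1 : Cmod (qpoch Q (2 * N) * (lsum T (zbox N) + T (Z.of_nat N))) < dl / 4 + dl / 4).
  { rewrite Cmod_mult. apply Rle_lt_trans with (B * (Cmod (lsum T (zbox N)) + K * r ^ N)).
    - apply Rmult_le_compat; auto using Cmod_ge_0; [apply HB|].
      eapply Rle_trans; [apply Cmod_triangle|]. lra.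
    - rewrite Rmult_plus_distr_l. apply Rplus_lt_compat.
      + apply Rmult_lt_reg_r with (/ B); [now apply Rinv_0_lt_compat|].
        replace (dl / 4 * / B) with (dl / (4 * B)) by (field; lra).
        replace (B * Cmod (lsum T (zbox N)) * / B) with (Cmod (lsum T (zbox N))) by (field; lra).
        exact H1.
      + eapply Rle_lt_trans; [|exact H2]. rewrite S_INR.
        pose proof (pos_INR N). pose proof (pow_le r N (proj1 Hr')).
        assert (0 <= B * K * (INR N * r ^ N)) by (repeat apply Rmult_le_pos; lra). lra. }
  assert (U2 : Cmod (lsum (fun j => T (idx j) * (qbinom Q (2 * N) j * qpoch Q N ^ 2 - qpoch Q (2 * N)))%C
         (seq 0 (S (2 * N)))) <= 2 * (K * D) * (INR (S N) * r ^ N)).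
  { eapply Rle_trans; [apply Cmod_lsum_le|].
    apply Rle_trans with (rsum (fun _ => K * D * r ^ N) (seq 0 (S (2 * N)))).
    - apply rsum_le_in. intros j Hj. apply in_seq in Hj.
      rewrite Cmod_mult. set (n := Nat.min N (Nat.min j (2 * N - j))).
      pose proof (qbinom_central_dist Q b B N j n (proj2 Hr) Hb HB
        ltac:(lia) ltac:(lia) ltac:(lia) ltac:(lia)) as W. fold r D in W.
      apply Rle_trans with ((K * r ^ Z.abs_nat (idx j)) * (D * r ^ n)).
      + apply Rmult_le_compat; auto using Cmod_ge_0. apply G.
      (* Near the ends the weights are poor but T is small, and |j - N| + min(j, 2N - j) = N
         balances the two exactly. Each of the 2N + 1 errors is thus at most K D r^N. *)
      + replace (r ^ N) with (r ^ Z.abs_nat (idx j) * r ^ n)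
          by (rewrite <- pow_add; f_equal; unfold idx, n; lia).
        right; ring.
    - rewrite rsum_const, !S_INR, mult_INR. simpl (INR 2).
      assert (0 <= K * D * r ^ N) by (apply Rmult_le_pos; [now apply Rmult_le_pos | apply pow_le; lra]).
      lra. }
  pose proof (Rle_trans _ _ _ lower (Cmod_triangle _ _)). lra.
Qed.

Theorem theorem5p4 (tau : C) (Htau : 0 < Im tau) :
  theta_const 1 (1/5) tau =
    Cmult (Copp (Cpow zeta5 2))
      (Cdiv (Cplus (Cmult (Cpow (d_ 1 tau) 3) (c_ 5 tau))
                   (Cmult (Cpow zeta5 3) (Cmult (Cpow (d_ 7 tau) 3) (c_ 1 tau))))
            (Cpow (c_ 3 tau) 3))
  /\
  theta_const 1 (3/5) tau =
    Cmult (Copp (Cpow zeta5 3))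
      (Cdiv (Cminus (Cmult (Cpow (c_ 7 tau) 3) (d_ 5 tau))
                    (Cmult (Cpow (c_ 9 tau) 3) (d_ 3 tau)))
            (Cpow (d_ 9 tau) 3)).
Proof.
  assert (Hc : c_ 3 tau <> RtoC 0) by (unfold c_; apply theta_const_neq0; lra).
  assert (Hd : d_ 9 tau <> RtoC 0) by (unfold d_; apply theta_const_neq0; lra).
  split.
  - transitivity (theta_const 1 (1/5) tau * c_ 3 tau ^ 3 / c_ 3 tau ^ 3)%C; [now field|].
    rewrite theta_relation_c3 by assumption. unfold Cdiv. ring.
  - transitivity (theta_const 1 (3/5) tau * d_ 9 tau ^ 3 / d_ 9 tau ^ 3)%C; [now field|].
    rewrite theta_relation_d9 by assumption. unfold Cdiv. ring.
Qed.
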